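(* Let $K$ be a kernel (of some order $\ell\in\mathbb{N}$, $\ell\ge1$), let $d=d_\infty$ or $d=d_{kuip,k}$ for some $k\in\mathbb{N}$, let $s:\mathbb{N}\to(0,\infty)$, and let $0<\varepsilon<1/2$ be such that $n^\varepsilon s(n)=o(1)$ as $n\to\infty$. Let $F_n$ denote the empirical distribution function of an iid sample $X_1,\dots,X_n$ drawn from a distribution with Lebesgue density $f$ and distribution function $F$. Suppose there exist constants $c,h_0>0$ such that $$d_\infty(F,F_h)\ge c\,h^\varepsilon\qquad\text{for all }0<h<h_0.$$ Let $h_{s,n}>0$ be a solution $h$ of $d(F_n,\hat F_n^h)=s(n)$. Then: 1. $n h_{s,n}\longrightarrow0$ with probability $1$; and 2. if $K$ is compactly supported and there exist $a,b>0$ such that $\lambda\{x:f(x)\ge b\}\ge a$, where $\lambda$ denotes Lebesgue measure on $\mathbb{R}$, then with probability $1$ $$\liminf_{n\to\infty}\|\hat f_{h_{s,n}}-f\|_1\ge ab>0.$$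
   Context: Kernel: for $\ell\in\mathbb{N}$, $\ell\ge1$, a function $K:\mathbb{R}\to\mathbb{R}$ (not necessarily nonnegative) is a kernel of order $\ell$ if $u^jK(u)\in L_1(\mathbb{R})$ for $j=0,\dots,\ell$, $\int K(u)\,du=1$, $\int u^jK(u)\,du=0$ for $j=1,\dots,\ell-1$, and $\int u^\ell K(u)\,du=k_\ell\in\mathbb{R}\setminus\{0\}$. For $h>0$, $K_h(u):=h^{-1}K(u/h)$, $\mathbb{K}(x):=\int_{-\infty}^xK(u)\,du$, and $F_h:=F*K_h$, i.e. $F_h(x)=\int F(x-u)K_h(u)\,du$. Estimators: $\hat f_h(x):=\frac1{nh}\sum_{i=1}^nK\left(\frac{x-X_i}{h}\right)$ and $\hat F_n^h(x):=\int_{-\infty}^x\hat f_h(t)\,dt=\frac1n\sum_{i=1}^n\mathbb{K}\left(\frac{x-X_i}{h}\right)$. Thus $\hat f_{h_{s,n}}$ is based on $X_1,\dots,X_n$ with bandwidth $h_{s,n}$. The samples for different $n$ are the initial segments of one iid sequence $X_1,X_2,\dots$. Distances: $d_\infty(F,G):=\sup_{x\in\mathbb{R}}|F(x)-G(x)|$; for $k\in\mathbb{N}$, $k\ge1$, $$d_{kuip,k}(F,G):=\sup_{a_1\le b_1\le a_2\le b_2\le\dots\le a_k\le b_k}\sum_{i=1}^k|(F(b_i)-F(a_i))-(G(b_i)-G(a_i))|.$$ Chosen bandwidth: $(h_{s,n})$ is an arbitrary sequence of positive random variables (arbitrary data-dependent selection among the solutions if there are several) such that almost surely $d(F_n,\hat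 F_n^{h_{s,n}})=s(n)$ for all sufficiently large $n$; existence of such solutions is presupposed. *)

(* Defs.v *)
From mathcomp Require Import all_boot all_order all_algebra finmap.
From mathcomp Require Import all_classical all_reals all_analysis.

Set Implicit Arguments.
Unset Strict Implicit.
Unset Printing Implicit Defensive.

Import Order.TTheory GRing.Theory Num.Theory.
Import numFieldNormedType.Exports.

Local Open Scope classical_set_scope.
Local Open Scope ring_scope.

(* [integrable] includes Borel measurability of K. *)
Definition is_kernel (R : realType) (l : nat) (K : R -> R) : Prop :=
  [/\ (1 <= l)%N,
      forall j : nat, (j <= l)%N ->
        (@lebesgue_measure R).-integrable setT (fun u => (u ^+ j * K u)%:E),
      \int[@lebesgue_measure R]_u K u = 1,
      forall j : nat, (1 <= j < l)%N ->
        \int[@lebesgue_measure R]_u (u ^+ j * K u) = 0 &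
      \int[@lebesgue_measure R]_u (u ^+ l * K u) != 0].

Definition scaled_kernel (R : realType) (K : R -> R) (h u : R) : R :=
  h^-1 * K (u / h).

(* F * K_h *)
Definition smoothed_df (R : realType) (F K : R -> R) (h x : R) : R :=
  \int[@lebesgue_measure R]_u (F (x - u) * scaled_kernel K h u).

Definition compactly_supported (R : realType) (K : R -> R) : Prop :=
  compact (closure [set u | K u != 0]).

Definition mutually_independent d (T : measurableType d) (R : realType)
    (P : probability T R) (X : nat -> {RV P >-> R}) : Prop :=
  forall (J : {fset nat}) (A : nat -> set R),
    (forall i, measurable (A i)) ->
    P (\bigcap_(i in [set` J]) (X i @^-1` A i)) =
    (\prod_(i <- J) P (X i @^-1` A i))%E.

Definition iid_sample d (T : measurableType d) (R : realType)
    (P : probability T R) (Q : probability R R)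
    (X : nat -> {RV P >-> R}) : Prop :=
  mutually_independent X /\
  forall (i : nat) (A : set R), measurable A -> distribution P (X i) A = Q A.

Definition is_lebesgue_density (R : realType) (Q : probability R R)
    (f : R -> R) : Prop :=
  [/\ measurable_fun setT f,
      forall x, 0 <= f x &
      forall A : set R, measurable A ->
        Q A = (\int[@lebesgue_measure R]_(x in A) (f x)%:E)%E].

Definition distribution_function (R : realType) (Q : probability R R)
    (x : R) : R :=
  fine (Q `]-oo, x]%classic).

(* The observations X_1, ..., X_n are x 0, ..., x n.-1. *)
Definition empirical_df (R : realType) (x : nat -> R) (n : nat) (t : R) : R :=
  n%:R^-1 * \sum_(i < n) (x i <= t)%R%:R.

Definition kernel_density_estimator (R : realType) (K : R -> R)
    (x : nat -> R) (n : nat) (h t : R) : R :=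
  (n%:R * h)^-1 * \sum_(i < n) K ((t - x i) / h).

Definition kernel_df_estimator (R : realType) (K : R -> R)
    (x : nat -> R) (n : nat) (h t : R) : R :=
  \int[@lebesgue_measure R]_(u in `]-oo, t])
    kernel_density_estimator K x n h u.

Definition d_infty (R : realType) (F G : R -> R) : \bar R :=
  ereal_sup (range (fun x => `|F x - G x|%:E)).

(* The chain a_1 <= b_1 <= a_2 <= ... <= b_k, split into the inequalities
   a_i <= b_i and b_i <= a_(i+1). *)
Definition d_kuip (R : realType) (k : nat) (F G : R -> R) : \bar R :=
  ereal_sup [set y | exists a b : 'I_k -> R,
    [/\ forall i, a i <= b i,
        forall i j : 'I_k, j = i.+1 :> nat -> b i <= a j &
        y = (\sum_(i < k)
               `|(F (b i) - F (a i)) - (G (b i) - G (a i))|)%:E]].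

(* Main.v *)
(** Write F_n for the empirical distribution function and F_{n,h} = F_n * K_h
    for the integrated kernel estimator.

    Smoothing is a contraction up to the factor ||K||_1, so
      d_infty(F, F_h) <= (1 + ||K||_1) d_infty(F, F_n) + d_infty(F_n, F_{n,h}),
    and d_kuip dominates d_infty here because both functions vanish at -oo.
    Chernoff bounds on a grid of n quantiles and the Borel-Cantelli lemma give
    d_infty(F_n, F) = O(n^-delta) almost surely for every delta < 1/2.  With
    eps < delta < 1/2 the bias condition then forces (n h)^eps -> 0 as soon as
    h < h0.

    Bandwidths h >= h0 must be excluded separately, since the bias condition
    says nothing about them; this is where the order l of the kernel enters.
    For psi(x) = (x / (1 + x^2))^l, the quantity
      1/n sum_i (int psi(y_i + t u) K(u) du - psi(y_i))
    is at most ||psi'||_1 times the distance between the empirical and the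
    smoothed distribution function of y_1, ..., y_n with bandwidth t.  Each
    summand is O(t^l) by Taylor expansion, because the lower moments of K
    vanish, and it is close to t^l k_l when |y_i| <= t M with t small, because
    psi(x) ~ x^l near 0.  Taking y_i = t X_i / h, where most X_i / h are bounded
    by tightness, bounds d_infty(F_n, F_{n,h}) below uniformly in h >= h0, which
    contradicts s(n) -> 0.

    If n h -> 0 and K vanishes outside [-S, S], the density estimator vanishes
    outside a set of measure 2 S n h, so its L1 distance to f is at least
    b (a - 2 S n h). *)

From HB Require Import structures.
Require Import Defs.
From mathcomp Require Import all_boot all_order all_algebra finmap.
From mathcomp Require Import all_classical all_reals all_analysis measurable_realfun.
From mathcomp Require Import ring lra zify.

Import Order.TTheory GRing.Theory Num.Theory.
Import numFieldNormedType.Exports.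

Set Implicit Arguments.
Unset Strict Implicit.
Unset Printing Implicit Defensive.

Local Open Scope classical_set_scope.
Local Open Scope ring_scope.

(** * Deviations of the empirical distribution function *)

Definition event_count d (T : measurableType d) (R : realType)
    (E : nat -> set T) (n : nat) (w : T) : R := \sum_(i < n) \1_(E i) w.

Lemma measurable_event_count d (T : measurableType d) (R : realType)
    (E : nat -> set T) (n : nat) : (forall i, measurable (E i)) ->
  measurable_fun setT (@event_count _ _ R E n).
Proof.
by move=> mE; apply: measurable_sum => i; exact: measurable_indic.
Qed.

Section Chernoff.
Context d (T : measurableType d) (R : realType) (P : probability T R).
Variables (E : nat -> set T) (p : R).
Hypothesis mE : forall i, measurable (E i).
Hypothesis indE : forall J : {fset nat},
  P (\bigcap_(i in [set` J]) E i) = (p ^+ #|` J|)%:E.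

(** Induction on [n]: expanding the last factor splits the integral into the one for [J] and [a]
    times the one for [J] enlarged by [n]. Carrying the indicator over [J] lets independence enter
    only through probabilities of intersections. *)
Lemma integral_prod_indep (a : R) (n : nat) (J : {fset nat}) : 0 <= a ->
  (forall i, i \in J -> (n <= i)%N) ->
  (\int[P]_w (\1_(\bigcap_(i in [set` J]) E i) w *
              \prod_(i < n) (1 + a * \1_(E i) w))%:E)%E =
  (p ^+ #|` J| * (1 + a * p) ^+ n)%:E.
Proof.
move=> a0; elim: n J => [|n IH] J nJ.
  rewrite mulr1 -indE -(setIT (\bigcap_(i in _) _)) -integral_indic //=; last first.
    by apply: fin_bigcap_measurable => // i _; exact: mE.
  by apply: eq_integral => w _; rewrite big_ord0 mulr1 setIT.
have nJn : n \notin J.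
  by apply/negP => /nJ; rewrite ltnn.
have mI (A : {fset nat}) : measurable (\bigcap_(i in [set` A]) E i).
  by apply: fin_bigcap_measurable => // i _; exact: mE.
have f0 (A : {fset nat}) w : 0 <= \1_(\bigcap_(i in [set` A]) E i) w *
    \prod_(i < n) (1 + a * \1_(E i) w) :> R.
  apply: mulr_ge0 => //; apply: prodr_ge0 => i _.
  by rewrite addr_ge0// mulr_ge0.
have mf (A : {fset nat}) : measurable_fun setT (fun w =>
    (\1_(\bigcap_(i in [set` A]) E i) w *
    \prod_(i < n) (1 + a * \1_(E i) w))%:E : \bar R).
  apply/measurable_EFinP; apply: measurable_funM => //.
  apply: measurable_prod => i _.
  by apply: measurable_funD => //; exact: measurable_funM.
transitivity (\int[P]_w ((\1_(\bigcap_(i in [set` J]) E i) w *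
    \prod_(i < n) (1 + a * \1_(E i) w))%:E +
  a%:E * (\1_(\bigcap_(i in [set` (n |` J)%fset]) E i) w *
    \prod_(i < n) (1 + a * \1_(E i) w))%:E))%E.
  apply: eq_integral => w _; rewrite big_ord_recr /= -EFinM -EFinD.
  rewrite set_fsetU1 bigcap_setU1 indicI /=; congr EFin.
  by rewrite /=; ring.
rewrite ge0_integralD //; last 3 first.
- by move=> w _; rewrite lee_fin.
- by move=> w _; rewrite -EFinM lee_fin mulr_ge0.
- exact: measurable_funeM.
rewrite ge0_integralZl_EFin //; last by move=> w _; rewrite lee_fin.
rewrite IH; last by move=> i /nJ /ltnW.
rewrite IH; last first.
  by move=> i; rewrite in_fset1U => /orP[/eqP->//|/nJ /ltnW].
rewrite cardfsU1 nJn /= -EFinM -EFinD; congr EFin.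
by rewrite add1n !exprS; ring.
Qed.

(** An indicator takes the values 0 and 1, so [expR (r * \1_E) = 1 + (expR r - 1) * \1_E], and the
    product formula applies with [J] empty. *)
Lemma event_count_mgf (r : R) (n : nat) : 0 <= r ->
  mmt_gen_fun P (event_count R E n) r = ((1 + (expR r - 1) * p) ^+ n)%:E.
Proof.
move=> r0; rewrite /mmt_gen_fun unlock.
have := @integral_prod_indep (expR r - 1) n fset0 _ _.
rewrite cardfs0 expr0 mul1r => <-//; last by rewrite subr_ge0 -expR0 ler_expR.
apply: eq_integral => w _ /=; congr EFin.
rewrite set_fset0 bigcap_set0 indicT mul1r /event_count.
rewrite mulr_suml expR_sum; apply: eq_bigr => i _.
by rewrite indicE; case: (_ \in _); rewrite ?mul1r ?mul0r ?expR0/=; ring.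
Qed.

Lemma event_count_Chernoff (n : nat) (t : R) : 0 <= p <= 1 -> 0 < t <= 2 ->
  (P [set w | (n%:R * (p + t) <= event_count R E n w)%R] <=
   (expR (- (n%:R * t ^+ 2 / 8)))%:E)%E.
Proof.
move=> /andP[p0 p1] /andP[t0 t2].
pose S : {RV P >-> R} := HB.pack (event_count R E n)
  (isMeasurableFun.Build _ _ _ _ _ (measurable_event_count n mE)).
(* The value [r = t / 4] minimises the exponent [n * (2 * r ^+ 2 - r * t)] reached below; [t <= 2]
   gives [r <= 1/2], the range in which the quadratic bound on [expR r] is proved. *)
have r0 : 0 < t / 4 by rewrite divr_gt0.
have r12 : t / 4 <= 1/2 by lra.
apply: (le_trans (chernoff S (n%:R * (p + t)) r0)).
rewrite /= event_count_mgf; last exact: ltW.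
rewrite -EFinM lee_fin.
set r := t / 4 in r0 r12 *.
(* From [(1 - r) * expR r <= 1] and [(1 - r) * (1 + r + 2 * r ^+ 2) = 1 + r ^+ 2 * (1 - 2 * r)]. *)
have er : expR r <= 1 + r + 2 * r ^+ 2.
  have h1 : 1 - r <= expR (- r) by exact: expR_ge1Dx.
  have h2 : 0 < 1 - r by lra.
  have : (1 - r) * expR r <= 1.
    by have := ler_wpM2r (expR_ge0 r) h1; rewrite -expRD addNr expR0.
  have h3 : 1 <= (1 - r) * (1 + r + 2 * r ^+ 2) by nra.
  by move=> h4; rewrite -(ler_pM2l h2); exact: le_trans h3.
have b1 : 1 + (expR r - 1) * p <= expR (r * p + 2 * r ^+ 2).
  apply: le_trans (expR_ge1Dx _).
  have e1 : expR r - 1 <= r + 2 * r ^+ 2 by lra.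
  have : (expR r - 1) * p <= (r + 2 * r ^+ 2) * p by rewrite ler_wpM2r.
  have : 2 * r ^+ 2 * p <= 2 * r ^+ 2 by rewrite ler_piMr // mulr_ge0 ?sqr_ge0.
  lra.
have b0 : 0 <= 1 + (expR r - 1) * p.
  by rewrite addr_ge0 // mulr_ge0 // subr_ge0 -expR0 ler_expR ltW.
apply: (@le_trans _ _ (expR (r * p + 2 * r ^+ 2) ^+ n * expR (- (r * (n%:R * (p + t)))))).
  by rewrite ler_wpM2r ?expR_ge0 // lerXn2r // ?nnegrE ?expR_ge0.
rewrite -expRM_natl -expRD ler_expR.
suff -> : n%:R * (r * p + 2 * r ^+ 2) - r * (n%:R * (p + t)) = - (n%:R * t ^+ 2 / 8) by [].
by rewrite /r; field.
Qed.

End Chernoff.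

(** * Distribution functions: monotonicity, limits, continuity and quantiles *)

Section DistributionFunction.
Context (R : realType) (Q : probability R R).
Local Notation F := (distribution_function Q).

Let idRV : {RV Q >-> R} := HB.pack (idfun : R -> R)
  (isMeasurableFun.Build _ _ R R idfun (@measurable_id _ R setT)).

Lemma distribution_functionE x : (F x)%:E = Q `]-oo, x]%classic.
Proof. by rewrite /distribution_function fineK // fin_num_measure. Qed.

Lemma distribution_function_cdf x :
  (F x)%:E = cdf idRV x.
Proof. by rewrite distribution_functionE. Qed.

Lemma distribution_function_bounds x : 0 <= F x <= 1.
Proof.
by rewrite -!lee_fin distribution_functionE probability_le1 // measure_ge0.
Qed.

Lemma distribution_function_le : {homo F : x y / x <= y}.
Proof.
move=> x y xy; rewrite -lee_fin !distribution_function_cdf.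
exact: cdf_nondecreasing.
Qed.

Lemma distribution_function_lt1 (e : R) : 0 < e -> exists x, 1 - e < F x.
Proof.
move=> e0; have := cvg_cdfy1 idRV.
move=> /fine_cvgP[_ /cvgrPdist_lt /(_ e e0)] /(@filter_ex _ _ _) [x] /=.
rewrite -distribution_function_cdf /= => hx; exists x.
move: hx; rewrite ltr_norml => /andP[_]; lra.
Qed.

Lemma distribution_function_gt0 (e : R) : 0 < e -> exists x, F x < e.
Proof.
move=> e0; have := cvg_cdfNy0 idRV.
move=> /fine_cvgP[_ /cvgrPdist_lt /(_ e e0)] /(@filter_ex _ _ _) [x] /=.
rewrite -distribution_function_cdf /= => hx; exists x.
move: hx; rewrite ltr_norml => /andP[+ _]; lra.
Qed.

Lemma density_integrable (f : R -> R) : is_lebesgue_density Q f ->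
  (@lebesgue_measure R).-integrable setT (EFin \o f).
Proof.
move=> [mf f0 Qf]; apply/integrableP; split; first exact/measurable_EFinP.
under eq_integral do rewrite /= ger0_norm //.
by rewrite -Qf // probability_setT ltry.
Qed.

(** Near [x], [F] is the constant [F (x - 1)] plus the integral of [f] from [x - 1], which is
    continuous in its upper limit. *)
Lemma distribution_function_continuous (f : R -> R) :
  is_lebesgue_density Q f -> continuous F.
Proof.
move=> df; have [mf f0 Qf] := df; have intf := density_integrable df => x.
have ab : x - 1 <= x + 1 by lra.
have intf' (A : set R) : measurable A ->
    (@lebesgue_measure R).-integrable A (EFin \o f).
  by move=> mA; apply: integrableS intf.
have /continuous_within_itvP : {within `[x - 1, x + 1],
    continuous (fun y => \int[@lebesgue_measure R]_(t in `[x - 1, y]) f t)}.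
  exact: parameterized_integral_continuous (intf' _ _).
case; first by lra.
move=> /(_ x); rewrite in_itv /= => /(_ _) cx _ _.
have {}cx : (fun y => \int[@lebesgue_measure R]_(t in `[x - 1, y]) f t) @ x -->
  \int[@lebesgue_measure R]_(t in `[x - 1, x]) f t by apply: cx; lra.
have FE y : x - 1 <= y ->
    F y = F (x - 1) + \int[@lebesgue_measure R]_(t in `[x - 1, y]) f t.
  move=> y1; apply: EFin_inj; rewrite EFinD !distribution_functionE.
  have -> : `]-oo, y]%classic = `]-oo, x - 1]%classic `|` `]x - 1, y]%classic :> set R.
    by rewrite -itv_bndbnd_setU // bnd_simp.
  rewrite measureU //; last first.
    apply/seteqP; split => // z [] /=; rewrite !in_itv /= => z1 /andP[z2 _].
    by move: z1; rewrite leNgt z2.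
  congr (_ + _)%E; etransitivity; first exact: Qf.
  rewrite /Rintegral fineK; last first.
    by apply: integrable_fin_num => //; exact: intf'.
  by rewrite integral_itv_obnd_cbnd //; apply/measurable_EFinP; exact: measurable_funS mf.
rewrite /continuous_at (FE x); last by lra.
apply: cvg_trans (cvgD (cvg_cst (F (x - 1))) cx).
apply: near_eq_cvg; near=> y.
rewrite (FE y) //.
near: y; exists 1 => //= z /=; rewrite ltr_norml => /andP[h1 h2].
by rewrite lerBlDr ltW // -ltrBlDl.
Unshelve. all: by end_near. Qed.

Lemma quantile_exists (q : R) : continuous F -> 0 < q < 1 ->
  exists x, F x = q.
Proof.
move=> cF /andP[q0 q1].
have [a Fa] := distribution_function_gt0 q0.
have [|b Fb] := @distribution_function_lt1 (1 - q); first by rewrite subr_gt0.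
have {}Fb : q < F b by lra.
have ab : a <= b.
  rewrite leNgt; apply/negP => /ltW /distribution_function_le.
  by move=> h; have := lt_trans Fa Fb; rewrite ltNge h.
have [| |c _ <-] := @IVT R F a b q ab; last by exists c.
- exact: continuous_subspaceT.
- by rewrite ge_min le_max (ltW Fa) (ltW Fb) orbT.
Qed.

End DistributionFunction.

(** By monotonicity, [G x] is trapped between its values at neighbouring grid points, where it is
    within [t] of [F]; the grid levels of [F] are [1 / n.+1%:R] apart. *)
Lemma grid_uniform_bound (R : realType) (F G : R -> R) (t : R) (n : nat)
    (x_ : nat -> R) : 0 <= t ->
  {homo F : x y / x <= y} -> {homo G : x y / x <= y} ->
  (forall x, 0 <= F x <= 1) -> (forall x, 0 <= G x <= 1) ->
  (forall j, (0 < j <= n)%N -> F (x_ j) = j%:R / n.+1%:R) ->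
  (forall j, (0 < j <= n)%N -> `|G (x_ j) - F (x_ j)| <= t) ->
  forall x, `|G x - F x| <= t + 2 / n.+1%:R.
Proof.
move=> t0 mF mG F01 G01 Fx GFx x.
have N0 : 0 < n.+1%:R :> R by [].
set N := n.+1%:R : R in N0 Fx *.
have [/andP[F0 F1] /andP[G0 G1]] := (F01 x, G01 x).
pose j := Num.truncn (N * F x).
have /andP[j1 j2] : j%:R <= N * F x < j.+1%:R.
  by rewrite /j truncn_itv // mulr_ge0 // ltW.
have hj1 : j%:R / N <= F x by rewrite ler_pdivrMr // mulrC.
have hj2 : F x < j.+1%:R / N by rewrite ltr_pdivlMr // mulrC.
have jS : j.+1%:R / N = j%:R / N + N^-1 by rewrite -natr1 mulrDl mul1r.
have N1 : 0 < N^-1 by rewrite invr_gt0.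
have x_lt y z : F y < F z -> y <= z.
  by move=> yz; rewrite leNgt; apply/negP => /ltW /mF; rewrite leNgt yz.
have up : G x - F x <= t + 2 * N^-1.
  have [jn|jn] := leqP j.+1 n.
    have jn' : (0 < j.+1 <= n)%N by [].
    have /mG : x <= x_ j.+1 by apply: x_lt; rewrite Fx.
    have := GFx _ jn'; rewrite Fx // ler_norml => /andP[_].
    by move: hj1 hj2 jS N1; move: N^-1 (j%:R / N) (j.+1%:R / N) => *; lra.
  have : n%:R / N <= F x.
    by apply: le_trans hj1; rewrite ler_pM2r // ler_nat.
  have : n%:R / N + N^-1 = 1.
    by rewrite -[X in _ + X]mul1r -mulrDl natr1 divff // gt_eqF.
  by move: N1; move: N^-1 (n%:R / N) => *; lra.
have lo : F x - G x <= t + 2 * N^-1.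
  (* The lower neighbour is [x_ j.-1], not [x_ j]: [F (x_ j)] may equal [F x], and only a strict
     inequality orders the points. This costs the second [1 / N]. *)
  have [j1'|j1'] := leqP j 1.
    have : j%:R / N <= N^-1.
      by rewrite -[leRHS]mul1r ler_pM2r // -[1]/(1%:R) ler_nat.
    move: hj2 jS N1; move: N^-1 (j%:R / N) (j.+1%:R / N) => *; lra.
  have jn : (j <= n.+1)%N.
    by rewrite -(ler_nat R); apply: le_trans j1 _; rewrite ler_piMr // ltW.
  have jn' : (0 < j.-1 <= n)%N by lia.
  have jS' : j%:R / N = j.-1%:R / N + N^-1.
    by rewrite -[in LHS](prednK (ltnW j1')) -natr1 mulrDl mul1r.
  have /mG : x_ j.-1 <= x.
    apply: x_lt; rewrite Fx //; apply: lt_le_trans hj1.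
    by rewrite jS' ltrDl.
  have := GFx _ jn'; rewrite Fx // ler_norml => /andP[+ _].
  move: hj2 jS jS' N1; move: N^-1 (j.-1%:R / N) (j%:R / N) (j.+1%:R / N) => *; lra.
by rewrite ler_norml lerNl opprB lo.
Qed.

Lemma measurable_superlevel (R : realType) (disp : measure_display)
    (T : measurableType disp) (f : T -> R) (r : R) :
  measurable_fun setT f -> measurable [set w | r <= f w].
Proof.
move=> mf; rewrite (_ : [set w | _] = setT `&` f @^-1` `[r, +oo[%classic).
  exact: mf.
by apply/seteqP; split => w /=; rewrite in_itv /= andbT // => -[].
Qed.

(** * Deviations of the empirical distribution function at one point *)

Section EmpiricalRate.
Context (R : realType) (disp : measure_display) (T : measurableType disp)
  (P : probability T R) (Q : probability R R) (X : nat -> {RV P >-> R}).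
Hypothesis iidX : iid_sample Q X.
Local Notation F := (distribution_function Q).
Local Notation Fn := (fun n w => empirical_df (fun i => X i w) n).

Lemma iid_preimage_indep (A : set R) : measurable A -> forall J : {fset nat},
  P (\bigcap_(i in [set` J]) X i @^-1` A) = (fine (Q A) ^+ #|` J|)%:E.
Proof.
move=> mA J; have [indX QX] := iidX.
rewrite (indX J (fun=> A)) //.
transitivity (\prod_(i <- J) (fine (Q A))%:E)%E.
  apply: eq_bigr => i _; rewrite fineK ?fin_num_measure //.
  by have := QX i A mA.
by rewrite prodEFin big_const_seq count_predT iter_mulr_1.
Qed.

Lemma empirical_df_count (x : R) n w :
  Fn n w x = n%:R^-1 * event_count R (fun i => X i @^-1` `]-oo, x]%classic) n w.
Proof.
congr (_ * _); apply: eq_bigr => i _; rewrite indicE.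
congr ((_ : bool)%:R); apply/idP/idP; rewrite inE /= in_itv //.
Qed.

(** Turns lower deviations of [F_n] into upper deviations of a count of complementary events, the
    direction that the Chernoff bound covers. *)
Lemma empirical_df_countC (x : R) n w : (0 < n)%N ->
  Fn n w x = 1 - n%:R^-1 *
    event_count R (fun i => X i @^-1` (~` `]-oo, x]%classic)) n w.
Proof.
move=> n0; have nn : n%:R != 0 :> R by rewrite pnatr_eq0 -lt0n.
rewrite empirical_df_count; apply/eqP; rewrite eq_sym subr_eq -mulrDr.
apply/eqP; rewrite /event_count -big_split /= (eq_bigr (fun=> 1)).
  by rewrite sumr_const card_ord mulVf.
move=> i _; rewrite preimage_setC indicC indicE.
by case: (_ \in _); rewrite ?addr0 ?add0r.
Qed.

Lemma measurable_empirical_df n x : measurable_fun setT (fun w => Fn n w x).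
Proof.
under eq_fun do rewrite empirical_df_count.
apply: measurable_funM => //; apply: measurable_event_count => i.
by rewrite -[X in measurable X]setTI; exact: measurable_funP.
Qed.

Lemma empirical_df_deviation (n : nat) (x t : R) : (0 < n)%N -> 0 < t <= 2 ->
  (P [set w | (t <= `|Fn n w x - F x|)%R] <=
   (2 * expR (- (n%:R * t ^+ 2 / 8)))%:E)%E.
Proof.
move=> n0 t02; have N0 : 0 < n%:R :> R by rewrite ltr0n.
pose A := `]-oo, x]%classic : set R.
have mA : measurable A by exact: measurable_itv.
have mX (B : set R) i : measurable B -> measurable (X i @^-1` B).
  by move=> mB; rewrite -[X in measurable X]setTI; exact: measurable_funP.
have mcount (B : set R) r : measurable B ->
    measurable [set w | (r <= event_count R (fun i => X i @^-1` B) n w)%R].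
  move=> mB; apply: measurable_superlevel.
  by apply: measurable_event_count => i; exact: mX.
have QC : fine (Q (~` A)) = 1 - F x.
  by rewrite probability_setC // fineB // fin_num_measure.
have F01 := distribution_function_bounds Q x.
pose U := [set w | (n%:R * (fine (Q A) + t) <=
                    event_count R (fun i => X i @^-1` A) n w)%R].
pose V := [set w | (n%:R * (fine (Q (~` A)) + t) <=
                    event_count R (fun i => X i @^-1` (~` A)) n w)%R].
have mCA : measurable (~` A) by exact: measurableC.
have UV : [set w | (t <= `|Fn n w x - F x|)%R] `<=` U `|` V.
  move=> w /=; rewrite ler_normr => /orP[h|h]; [left|right]; rewrite /U /V /=.
    rewrite mulrC -ler_pdivlMr // mulrC -empirical_df_count.
    by move: h; rewrite /F -/A; lra.
  rewrite QC mulrC -ler_pdivlMr // mulrC.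
  by move: h; rewrite empirical_df_countC //; lra.
have mS : measurable [set w | (t <= `|Fn n w x - F x|)%R].
  apply: measurable_superlevel.
  apply: measurableT_comp => //; apply: measurable_funB => //.
  exact: measurable_empirical_df.
have mU : measurable U by exact: mcount.
have mV : measurable V by exact: mcount.
apply: (@le_trans _ _ (P (U `|` V))).
  by apply: le_measure; rewrite ?inE //; exact: measurableU.
apply: (le_trans (measureU2 _ mU mV)).
rewrite mulr2n mulrDl mul1r EFinD; apply: leeD.
  exact: (event_count_Chernoff (mX _ ^~ mA) (iid_preimage_indep mA)).
apply: (event_count_Chernoff (mX _ ^~ mCA) (iid_preimage_indep mCA)) => //.
by rewrite QC; lra.
Qed.

Lemma empirical_df_bounds n w x : 0 <= Fn n w x <= 1.
Proof.
have S0 : 0 <= \sum_(i < n) (X i w <= x)%R%:R :> R by exact: sumr_ge0.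
have S1 : \sum_(i < n) (X i w <= x)%R%:R <= n%:R :> R.
  apply: (@le_trans _ _ (\sum_(i < n) 1)); last by rewrite sumr_const card_ord.
  by apply: ler_sum => i _; rewrite lern1 leq_b1.
rewrite /empirical_df mulr_ge0 ?invr_ge0 //=.
case: n S0 S1 => [|n] S0 S1; first by rewrite invr0 mul0r.
by rewrite mulrC ler_pdivrMr // mul1r.
Qed.

Lemma empirical_df_le n w : {homo Fn n w : x y / x <= y}.
Proof.
move=> x y xy; rewrite /empirical_df ler_wpM2l ?invr_ge0 //.
apply: ler_sum => i _; rewrite ler_nat; case: (leP (X i w) x) => // h.
by rewrite (le_trans h xy).
Qed.

End EmpiricalRate.

(** The exponent is [n ^ g / 8] with [g = 1 - 2 * delta > 0], so the exponential beats every power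
    of [n]. Decay of order [n ^ -2] suffices, and it is stated in telescoping form. *)
Lemma stretched_exponential_bound (R : realType) (delta : R) : 0 < delta < 1 / 2 ->
  exists2 C : R, 0 <= C & forall n, (0 < n)%N ->
    n%:R * (2 * expR (- (n%:R * (n%:R `^ (- delta)) ^+ 2 / 8))) <=
    C * (n%:R^-1 - n.+1%:R^-1).
Proof.
move=> /andP[d0 d12]; pose g := 1 - 2 * delta.
have g0 : 0 < g by rewrite /g; lra.
(* Chosen so that [m.+1 * g >= 3]: the single term of degree [m.+1] in the exponential series then
   dominates [n ^ 3 / D]. *)
pose m := Num.truncn (3 / g).
have mg : 3 <= m.+1%:R * g by rewrite -ler_pdivrMr // ltW // truncnS_gt.
pose D := 8 ^+ m.+1 * m.+1`!%:R : R.
have D0 : 0 < D by rewrite mulr_gt0 ?exprn_gt0 // ltr0n fact_gt0.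
exists (4 * D) => [|n n0]; first by rewrite mulr_ge0 // ltW.
have N0 : 0 < n%:R :> R by rewrite ltr0n.
have N1 : 1 <= n%:R :> R by rewrite ler1n.
set y := _ / 8.
have yE : y = n%:R `^ g / 8.
  rewrite /y; congr (_ / _); rewrite expr2 -[X in X * _](powRr1 (ltW N0)).
  have nz : n%:R != 0 :> R by rewrite gt_eqF.
  by rewrite -!powRD ?nz ?implybT // /g; congr (_ `^ _); ring.
have y0 : 0 <= y by rewrite yE mulr_ge0 // powR_ge0.
have expy : n%:R ^+ 3 / D <= expR y.
  apply: (@le_trans _ _ (y ^+ m.+1 / m.+1`!%:R)); last first.
    by apply: le_trans (expR_ge1Dxn m y0); rewrite lerDr.
  rewrite yE exprMn exprVn /D invfM mulrA.
  rewrite !ler_pM2r ?invr_gt0 ?exprn_gt0 ?ltr0n ?fact_gt0 // -powR_mulrn ?(ltW N0) // -powR_mulrn ?powR_ge0 //.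
  by rewrite -powRrM ler_powR // mulrC.
rewrite expRN.
have : n%:R ^+ 3 <= D * expR y by rewrite mulrC -ler_pdivrMr.
have E0 := expR_gt0 y.
have -> : 4 * D * (n%:R^-1 - n.+1%:R^-1) = 4 * D / (n%:R * (n%:R + 1)).
  by rewrite -natr1; field; rewrite natr1 !pnatr_eq0 -!lt0n n0.
move=> h; rewrite mulrA ler_pdivrMr // mulrAC ler_pdivlMr; last first.
  by rewrite mulr_gt0 // addr_gt0.
apply: le_trans (_ : 4 * n%:R ^+ 3 <= _); last by rewrite -mulrA ler_pM2l.
rewrite (_ : n%:R * 2 * (n%:R * (n%:R + 1)) = 2 * n%:R ^+ 2 * (n%:R + 1)); last by ring.
rewrite (_ : 4 * n%:R ^+ 3 = 2 * n%:R ^+ 2 * (2 * n%:R)); last by ring.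
by rewrite ler_wpM2l ?mulr_ge0 ?sqr_ge0 //; lra.
Qed.

Lemma stretched_exponential_summable (R : realType) (delta : R) :
  0 < delta < 1 / 2 ->
  (\sum_(n <oo) (n%:R * (2 * expR (- (n%:R * (n%:R `^ (- delta)) ^+ 2 / 8))))%:E
   < +oo :> \bar R)%E.
Proof.
move=> /stretched_exponential_bound [C C0 bnd].
pose u n : R := n%:R * (2 * expR (- (n%:R * (n%:R `^ (- delta)) ^+ 2 / 8))).
apply: (@le_lt_trans _ _ C%:E); last exact: ltry.
have u0 n : 0 <= u n by rewrite mulr_ge0 // mulr_ge0 // expR_ge0.
apply: lime_le; first by apply: is_cvg_nneseries => n _ _; rewrite lee_fin.
apply: nearW => n; rewrite /= sumEFin lee_fin.
(* The telescoping bound holds from index 1 on; the term of index 0 is 0, so the induction starts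
   from [n.+1 = 1] with both sides 0. *)
suff : \sum_(0 <= i < n.+1) u i <= C * (1 - n.+1%:R^-1).
  rewrite big_nat_recr //= => h.
  apply: (@le_trans _ _ (\sum_(0 <= i < n) u i + u n)); first by rewrite lerDl.
  by apply: le_trans h _; rewrite mulrBr mulr1 gerBl mulr_ge0.
elim: n => [|n IH].
  by rewrite big_nat1 /u mul0r invr1 subrr mulr0.
rewrite big_nat_recr //=; apply: le_trans (lerD IH (bnd n.+1 isT)) _.
by rewrite -mulrDr addrA subrK.
Qed.

(** A union bound over the quantiles of levels [j / n.+1] gives summable probabilities; outside the
    resulting limsup event the grid lemma extends the bound to all [x]. *)
Theorem empirical_df_rate (R : realType) (disp : measure_display)
    (T : measurableType disp) (P : probability T R) (Q : probability R R)
    (X : nat -> {RV P >-> R}) (delta : R) :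
  iid_sample Q X -> continuous (distribution_function Q) ->
  0 < delta < 1 / 2 ->
  \forall w \ae P, \forall n \near \oo, forall x,
    `|empirical_df (fun i => X i w) n x - distribution_function Q x| <=
    n%:R `^ (- delta) + 2 / n.+1%:R.
Proof.
move=> iidX cF d12; have /andP[d0 _] := d12.
pose F := distribution_function Q.
(* For [0 < j <= n] the level lies strictly between 0 and 1, so continuity provides a quantile; the
   default 0 can only occur at other indices. *)
pose q n j : R := xget 0 [set x | F x = j%:R / n.+1%:R].
have Fq n j : (0 < j <= n)%N -> F (q n j) = j%:R / n.+1%:R.
  move=> /andP[j0 jn]; rewrite /q; case: xgetP => [y -> //|].
  have [|x Fx] := @quantile_exists _ Q (j%:R / n.+1%:R) cF.
    by rewrite divr_gt0 ?ltr0n //= ltr_pdivrMr // mul1r ltr_nat.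
  by move=> /(_ x).
(* Shifted by one: [j < n] runs over the grid points [1, ..., n]. *)
pose dev n j := [set w | (n%:R `^ (- delta) <=
  `|empirical_df (fun i => X i w) n (q n j.+1) - F (q n j.+1)|)%R].
have mdev n j : measurable (dev n j).
  apply: measurable_superlevel.
  apply: measurableT_comp => //; apply: measurable_funB => //.
  exact: measurable_empirical_df.
pose B n := \big[setU/set0]_(j < n) dev n j.
have mB n : measurable (B n) by apply: bigsetU_measurable.
have PB n : (P (B n) <=
    (n%:R * (2 * expR (- (n%:R * (n%:R `^ (- delta)) ^+ 2 / 8))))%:E)%E.
  apply: (le_trans (Boole_inequality _ _)) => //.
  case: n => [|n]; first by rewrite big_ord0 mul0r.
  apply: (@le_trans _ _ (\sum_(j < n.+1) (2 * expR (- (n.+1%:R *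
      (n.+1%:R `^ (- delta)) ^+ 2 / 8)))%:E)%E).
    apply: lee_sum => j _; apply: empirical_df_deviation => //.
    rewrite powR_gt0 //= powRN; apply: (@le_trans _ _ 1); last by lra.
    rewrite invf_le1 ?powR_gt0 //.
    have h1 : 1 <= n.+1%:R :> R by rewrite ler1n.
    by have := ler_powR h1 (ltW d0); rewrite powRr0.
  by rewrite sumEFin lee_fin sumr_const card_ord -[leLHS]mulr_natl.
have PB0 : P (lim_sup_set B) = 0%E.
  apply: lim_sup_set_cvg0 => //.
  apply: le_lt_trans (stretched_exponential_summable d12).
  by apply: lee_nneseries => // n _; exact: PB.
exists (lim_sup_set B); split => //.
  by apply: bigcap_measurable => // n _; exact: bigcup_measurable.
move=> w /= nP n _; apply: contrapT => hn; apply: nP.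
exists n.+1 => //= m nm x.
apply: (@grid_uniform_bound _ F (empirical_df (fun i => X i w) m) _ m (q m)).
- exact: powR_ge0.
- exact: distribution_function_le.
- exact: empirical_df_le.
- exact: distribution_function_bounds.
- exact: empirical_df_bounds.
- exact: Fq.
- move=> [//|j] /= jm; rewrite leNgt; apply/negP => /ltW h; apply: hn.
  by exists m; [exact: ltnW|rewrite /B -bigcup_mkord; exists j].
Qed.

(** * Smoothing by a kernel *)

Section AffineChange.
Context (R : realType).
Local Notation mu := (@lebesgue_measure R).
Variables (h c : R).
Hypothesis h0 : 0 < h.
Let phi (u : R) : R := (u - c) / h.

Let measurable_phi : measurable_fun setT phi.
Proof. by apply: measurable_funM => //; exact: measurable_funB. Qed.

Let hn : {nonneg R} := NngNum (ltW h0).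

Let mphi : measurable_fun setT (phi : measurableTypeR R -> measurableTypeR R).
Proof. exact: measurable_phi. Qed.

Let push : {measure set (measurableTypeR R) -> \bar R} :=
  measure_function_pushforward__canonical__measure_function_Measure mu mphi.

(** The preimage of []a, b]] under [phi] is []h * a + c, h * b + c]], so [1 / h] times the
    pushforward agrees with Lebesgue measure on half-open intervals, hence everywhere by
    uniqueness. *)
Let lebesgue_measure_affine (A : set R) : measurable A ->
  push A = mscale hn mu A.
Proof.
pose k : {nonneg R} := NngNum (ltW (divr_gt0 ltr01 h0)).
pose nu : {measure set (measurableTypeR R) -> \bar R} :=
  mscale k push.
have nuE X : ocitv X -> mu X = nu X.
  case=> -[a b] _ <-.
  rewrite [RHS](_ : _ = (1 / h)%:E * mu (phi @^-1` `]a, b]%classic))%E //.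
  have -> : phi @^-1` `]a, b]%classic = `]h * a + c, h * b + c]%classic.
    apply/seteqP; split => x /=; rewrite /phi !in_itv /= ltr_pdivlMr //
      ler_pdivrMr // ltrBrDr lerBlDr ![_ * h]mulrC //.
  rewrite !lebesgue_measure_itv /= !lte_fin ltrD2r ltr_pM2l //.
  case: ifPn => ab; last by rewrite mule0.
  rewrite -!EFinB -EFinM; congr EFin; field.
  by rewrite gt_eqF.
move=> mA; rewrite /mscale /= (lebesgue_measure_unique nuE mA).
rewrite [in RHS](_ : nu A = (1 / h)%:E * push A)%E //.
by rewrite muleA -EFinM mul1r divff ?gt_eqF // mul1e.
Qed.

Lemma integrable_affine (g : R -> R) : mu.-integrable setT (EFin \o g) ->
  mu.-integrable setT (EFin \o (fun u => g ((u - c) / h))).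
Proof.
move=> /integrableP[/measurable_EFinP mg gfin].
have mgp : measurable_fun setT (g \o phi) by exact: measurableT_comp.
apply/integrableP; split; first exact/measurable_EFinP.
have -> : (\int[mu]_x `|(EFin \o (fun u => g ((u - c) / h)%R)) x| =
    h%:E * \int[mu]_x `|(EFin \o g) x|)%E; last first.
  by apply: lte_mul_pinfty; rewrite ?lee_fin ?ltW.
rewrite -(ge0_integral_mscale _ measurableT hn) //; last first.
  by apply: measurableT_comp => //; exact/measurable_EFinP.
transitivity (\int[push]_x `|(EFin \o g) x|)%E; last first.
  by apply: eq_measure_integral => A mA _; exact: lebesgue_measure_affine.
rewrite [RHS](ge0_integral_pushforward mphi) //.
by apply: measurableT_comp => //; exact/measurable_EFinP.
Qed.

Lemma Rintegral_affine (g : R -> R) : mu.-integrable setT (EFin \o g) ->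
  \int[mu]_u g ((u - c) / h) = h * \int[mu]_v g v.
Proof.
move=> ig; have /integrableP[/measurable_EFinP mg _] := ig.
have ge0 (f : R -> \bar R) : measurable_fun setT f -> (forall x, 0 <= f x)%E ->
    (\int[mu]_x f (phi x) = h%:E * \int[mu]_x f x)%E.
  move=> mf f0; rewrite -(ge0_integral_mscale _ measurableT hn) //.
  rewrite -[LHS](ge0_integral_pushforward mphi mu measurableT) //.
  rewrite -[LHS]/(\int[push]_x f x)%E.
  by apply: eq_measure_integral => A mA _; exact: lebesgue_measure_affine.
have mE : measurable_fun setT (EFin \o g) by exact/measurable_EFinP.
rewrite /Rintegral; transitivity (fine (h%:E * \int[mu]_x (g x)%:E)%E); last first.
  by rewrite fineM //; exact: integrable_fin_num.
congr fine; rewrite integralE [in RHS]integralE.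
have -> : ((fun x => (g ((x - c) / h)%R)%:E)^\+ = (fun x => (EFin \o g)^\+ (phi x)))%E.
  by apply/funext => x; rewrite !funeposE.
have -> : ((fun x => (g ((x - c) / h)%R)%:E)^\- = (fun x => (EFin \o g)^\- (phi x)))%E.
  by apply/funext => x; rewrite !funenegE.
rewrite !ge0 //; last 2 first.
- exact: measurable_funeneg.
- exact: measurable_funepos.
rewrite [RHS]muleBr //; apply: fin_num_adde_defr.
exact: integrable_pos_fin_num ig.
Qed.

End AffineChange.

(** * The integrated kernel estimator as a smoothed empirical distribution function *)

Section KernelEstimator.
Context (R : realType).
Local Notation mu := (@lebesgue_measure R).
Variables (K : R -> R).
Hypothesis iK : mu.-integrable setT (EFin \o K).

Lemma integrable_bounded_mul (g : R -> R) (M : R) : measurable_fun setT g ->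
  (forall x, `|g x| <= M) -> mu.-integrable setT (EFin \o (fun v => g v * K v)).
Proof.
move=> mg gM; have mK : measurable_fun setT K.
  by apply/measurable_EFinP; exact: measurable_int iK.
have M0 : 0 <= M by exact: le_trans (gM 0).
apply: (le_integrable measurableT _ _ (integrableZl measurableT M iK)).
  by apply/measurable_EFinP; exact: measurable_funM.
by move=> v _ /=; rewrite lee_fin !normrM (ger0_norm M0) ler_wpM2r.
Qed.

Lemma measurable_itvNy_ind (a h t : R) :
  measurable_fun setT (fun v : R => (a + h * v <= t)%R%:R : R).
Proof.
rewrite (_ : (fun v => _) = \1_[set v | a + h * v <= t]).
  apply: measurable_indic; rewrite -[X in measurable X]setTI.
  rewrite (_ : [set v | a + h * v <= t] =
    (fun v => a + h * v) @^-1` `]-oo, t]%classic); last first.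
    by apply/seteqP; split => x /=; rewrite in_itv.
  have : measurable_fun setT (fun v : R => a + h * v).
    by apply: measurable_funD => //; exact: measurable_funM.
  by apply.
by apply/funext => v; rewrite indicE; congr ((_ : bool)%:R); apply/idP/idP;
  rewrite inE.
Qed.

Lemma integrable_itvNy_ind (a h t : R) :
  mu.-integrable setT (EFin \o (fun v => (a + h * v <= t)%R%:R * K v)).
Proof.
apply: (@integrable_bounded_mul _ 1); first exact: measurable_itvNy_ind.
by move=> v; rewrite normr_nat lern1 leq_b1.
Qed.

Lemma integrable_Rsum n (g : 'I_n -> R -> R) :
  (forall i, mu.-integrable setT (EFin \o g i)) ->
  mu.-integrable setT (EFin \o (fun v => \sum_(i < n) g i v)).
Proof.
move=> ig; rewrite (_ : _ \o _ = fun u => \sum_(i < n) (EFin \o g i) u)%E.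
  by apply: integrable_sum.
by apply/funext => u /=; rewrite sumEFin.
Qed.

Lemma Rintegral_sum n (g : 'I_n -> R -> R) :
  (forall i, mu.-integrable setT (EFin \o g i)) ->
  \int[mu]_v (\sum_(i < n) g i v) = \sum_(i < n) \int[mu]_v g i v.
Proof.
move=> ig; rewrite /Rintegral.
under eq_integral do rewrite -sumEFin.
rewrite integral_sum // sum_fine // => i _.
exact: integrable_fin_num (ig i).
Qed.

(** Substitute [u = x i + h * v] in each summand. With the half-line turned into an indicator,
    integrals can be exchanged and the sample and bandwidth rescaled jointly. *)
Lemma kernel_df_estimatorE (x : nat -> R) (n : nat) (h t : R) : 0 < h ->
  kernel_df_estimator K x n h t =
  n%:R^-1 * \sum_(i < n) \int[mu]_v ((x i + h * v <= t)%R%:R * K v).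
Proof.
move=> h0; have hz : h != 0 by rewrite gt_eqF.
pose g i v := (x i + h * v <= t)%R%:R * K v.
have ig i : mu.-integrable setT (EFin \o g i) by exact: integrable_itvNy_ind.
rewrite /kernel_df_estimator Rintegral_mkcond.
transitivity (\int[mu]_u ((n%:R * h)^-1 * \sum_(i < n) g i ((u - x i) / h))).
  apply: eq_Rintegral => u _; rewrite patchE /kernel_density_estimator.
  have gE i : g i ((u - x i) / h) = (u <= t)%R%:R * K ((u - x i) / h).
    by rewrite /g (_ : x i + h * _ = u) //; field.
  under [in RHS]eq_bigr do rewrite gE.
  rewrite -mulr_sumr mem_setE in_itv /=.
  by case: (u <= t); rewrite ?mul1r // mul0r mulr0.
have ig' i : mu.-integrable setT (EFin \o (fun u => g i ((u - x i) / h))).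
  exact: integrable_affine.
rewrite RintegralZl //; last exact: integrable_Rsum.
rewrite Rintegral_sum // invfM -mulrA mulr_sumr; congr (_ * _).
by apply: eq_bigr => i _; rewrite Rintegral_affine // mulrA mulVf // mul1r.
Qed.

(** This is the identity [F_{n,h} = F_n * K_h] in the variable [v = u / h]: [x i + h * v <= t] means
    [x i <= t - h * v]. *)
Lemma kernel_df_estimator_smoothing (x : nat -> R) (n : nat) (h t : R) : 0 < h ->
  kernel_df_estimator K x n h t =
  \int[mu]_v (empirical_df x n (t - h * v) * K v).
Proof.
move=> h0; rewrite kernel_df_estimatorE // -Rintegral_sum; last first.
  by move=> i; exact: integrable_itvNy_ind.
rewrite -RintegralZl //; last first.
  by apply: integrable_Rsum => i; exact: integrable_itvNy_ind.
apply: eq_Rintegral => v _; rewrite /empirical_df -mulr_suml mulrA.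
by congr (_ * _ * _); apply: eq_bigr => i _; rewrite lerBrDr.
Qed.

Lemma measurable_reflection (h t : R) : measurable_fun setT (fun v : R => t - h * v).
Proof.
apply: measurable_funB; first exact: measurable_cst.
by apply: measurable_funM; [exact: measurable_cst|exact: measurable_id].
Qed.

Lemma smoothed_dfE (F : R -> R) (h t : R) : 0 < h -> measurable_fun setT F ->
  (forall x, `|F x| <= 1) ->
  smoothed_df F K h t = \int[mu]_v (F (t - h * v) * K v).
Proof.
move=> h0 mF F1; have hz : h != 0 by rewrite gt_eqF.
have ig : mu.-integrable setT (EFin \o (fun v => F (t - h * v) * K v)).
  apply: (@integrable_bounded_mul _ 1) => //.
  by apply: measurableT_comp => //; exact: measurable_reflection.
have ig' := @integrable_affine _ h 0 h0 _ ig.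
rewrite /smoothed_df -[RHS](mulKf hz) -(Rintegral_affine 0 h0 ig) -RintegralZl //.
apply: eq_Rintegral => u _; rewrite /scaled_kernel subr0 mulrCA.
by rewrite [h * _]mulrC divfK.
Qed.

Lemma smoothing_contraction (F : R -> R) (x : nat -> R) (n : nat) (h t D : R) :
  0 < h -> measurable_fun setT F -> (forall x, `|F x| <= 1) ->
  measurable_fun setT (empirical_df x n) ->
  (forall y, `|empirical_df x n y - F y| <= D) ->
  `|smoothed_df F K h t - kernel_df_estimator K x n h t| <=
  D * \int[mu]_v `|K v|.
Proof.
move=> h0 mF F1 mE FD.
have mt := measurable_reflection h t.
have iF : mu.-integrable setT (EFin \o (fun v => F (t - h * v) * K v)).
  by apply: (@integrable_bounded_mul _ 1) => //; exact: measurableT_comp.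
have iE : mu.-integrable setT (EFin \o (fun v => empirical_df x n (t - h * v) * K v)).
  apply: (@integrable_bounded_mul _ (D + 1)); first exact: measurableT_comp.
  move=> v; set y := t - h * v.
  by rewrite -(subrK (F y) (empirical_df x n y)) (le_trans (ler_normD _ _)) // lerD.
rewrite smoothed_dfE // kernel_df_estimator_smoothing // -RintegralB //.
have iFE : mu.-integrable setT (EFin \o (fun v => F (t - h * v) * K v -
    empirical_df x n (t - h * v) * K v)).
  exact: (integrableB measurableT iF iE).
have iaK : mu.-integrable setT (EFin \o (fun v => `|K v|)).
  exact: integrable_norm.
apply: (le_trans (le_normr_Rintegral _ _)) => //.
rewrite -RintegralZl //; apply: le_Rintegral => //.
- exact: integrable_norm.
- exact: (integrableZl measurableT D iaK).
- by move=> v _; rewrite -mulrBl normrM ler_wpM2r // distrC.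
Qed.

(** Dominated convergence with majorant [|K|]: at each fixed [v] the indicator is eventually 0. *)
Lemma kernel_tail_cvg0 (a h : R) : 0 < h ->
  \int[mu]_v ((a + h * v <= - m%:R)%R%:R * K v) @[m --> \oo] --> (0 : R).
Proof.
move=> h0.
have mK : measurable_fun setT K by apply/measurable_EFinP; exact: measurable_int iK.
have [|||||] := @dominated_convergence _ _ _ mu setT measurableT
  (fun m v => ((a + h * v <= - m%:R)%R%:R * K v)%:E) (cst 0%E)
  (fun v => `|K v|%:E).
- by move=> m; exact: measurable_int (integrable_itvNy_ind a h (- m%:R)).
- exact: measurable_cst.
- apply: aeW => v _; apply: cvg_near_cst; near=> m.
  rewrite leNgt (_ : _ < _); first by rewrite mul0r.
  rewrite ltrNl; near: m; exact: nbhs_infty_gtr.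
- exact: integrable_norm.
- apply: aeW => v m _; rewrite /= lee_fin normrM.
  by rewrite normr_nat ler_piMl // lern1 leq_b1.
- move=> _ _; rewrite integral0 => /fine_cvg.
  exact.
Unshelve. all: by end_near. Qed.

Lemma kernel_df_estimator_cvg0 (x : nat -> R) (n : nat) (h : R) : 0 < h ->
  kernel_df_estimator K x n h (- m%:R) @[m --> \oo] --> (0 : R).
Proof.
move=> h0; under eq_fun do rewrite kernel_df_estimatorE //.
suff : n%:R^-1 * (\sum_(i < n) \int[mu]_v ((x i + h * v <= - m%:R)%R%:R * K v))
    @[m --> \oo] --> n%:R^-1 * (\sum_(i < n) (0 : R)).
  by rewrite big1 // mulr0.
apply: cvgM; first exact: cvg_cst.
apply: cvg_big; last by move=> i _; exact: kernel_tail_cvg0.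
exact: add_continuous.
Qed.

End KernelEstimator.

(** * A test function that detects the order of the kernel *)

Lemma is_derive_continuous (R : realType) (f : R -> R) (x df : R) :
  is_derive x 1 f df -> {for x, continuous f}.
Proof.
by move=> [fx _]; apply: differentiable_continuous; exact/derivable1_diffP.
Qed.

Section TestFunctions.
Context (R : realType).

(* The witch of Agnesi and its product with the identity: polynomials in these
   two bounded functions are stable under derivation. *)
Definition agnesi (x : R) : R := (1 + x ^+ 2)^-1.
Definition agnesi_id (x : R) : R := x * agnesi x.

Lemma agnesi_den_gt0 (x : R) : 0 < 1 + x ^+ 2.
Proof. by rewrite ltr_pwDl // sqr_ge0. Qed.

Lemma agnesi_gt0 (x : R) : 0 < agnesi x.
Proof. by rewrite invr_gt0 agnesi_den_gt0. Qed.

Lemma agnesi_le1 (x : R) : agnesi x <= 1.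
Proof. by rewrite invf_le1 ?agnesi_den_gt0 // lerDl sqr_ge0. Qed.

Lemma agnesiE (x : R) : agnesi x * (1 + x ^+ 2) = 1.
Proof. by rewrite mulVf // gt_eqF // agnesi_den_gt0. Qed.

Lemma agnesi_id_sqr (x : R) : agnesi_id x ^+ 2 = agnesi x - agnesi x ^+ 2.
Proof.
have := agnesiE x; rewrite /agnesi_id; move: (agnesi x) => b h.
have -> : (x * b) ^+ 2 = b * (b * (1 + x ^+ 2)) - b ^+ 2 by ring.
by rewrite h mulr1.
Qed.

Lemma agnesi_id_sqr_le (x : R) : agnesi_id x ^+ 2 <= agnesi x.
Proof. by rewrite agnesi_id_sqr gerBl sqr_ge0. Qed.

Lemma agnesi_id_le1 (x : R) : `|agnesi_id x| <= 1.
Proof.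
rewrite -(@ler_pXn2r _ 2) ?nnegrE // expr1n -normrX ger0_norm ?sqr_ge0 //.
exact: le_trans (agnesi_id_sqr_le x) (agnesi_le1 x).
Qed.

Lemma is_derive_agnesi (x : R) : is_derive x 1 agnesi (- 2 * (agnesi_id x * agnesi x)).
Proof.
have den : 1 + x ^+ 2 != 0 by rewrite gt_eqF // agnesi_den_gt0.
apply: is_derive_eq; first exact: is_deriveV.
rewrite /agnesi_id /agnesi -![_ *: _]/(_ * _) /=.
by field.
Qed.

Lemma is_derive_agnesi_id (x : R) :
  is_derive x 1 agnesi_id (agnesi x - 2 * agnesi_id x ^+ 2).
Proof.
have := is_derive_agnesi x => db.
apply: is_derive_eq.
rewrite /agnesi_id -![_ *: _]/(_ * _) /=.
by ring.
Qed.

(* All derivatives of a test function are bounded. *)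
Inductive test_function : (R -> R) -> Prop :=
| test_cst c : test_function (cst c)
| test_agnesi : test_function agnesi
| test_agnesi_id : test_function agnesi_id
| test_add f g : test_function f -> test_function g -> test_function (f \+ g)
| test_mul f g : test_function f -> test_function g -> test_function (f \* g).

Lemma test_function_bounded f : test_function f ->
  exists2 C, 0 <= C & forall x, `|f x| <= C.
Proof.
elim=> [c|||{}f g _ [C C0 fC] _ [D D0 gD]|{}f g _ [C C0 fC] _ [D D0 gD]].
- by exists `|c|.
- by exists 1 => // x; rewrite ger0_norm ?agnesi_le1 // ltW // agnesi_gt0.
- by exists 1 => // x; exact: agnesi_id_le1.
- exists (C + D) => [|x]; first exact: addr_ge0.
  by rewrite (le_trans (ler_normD _ _)) // lerD.
- exists (C * D) => [|x]; first exact: mulr_ge0.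
  by rewrite normrM ler_pM.
Qed.

Lemma test_function_derivative f : test_function f ->
  exists2 f', test_function f' & forall x : R, is_derive x 1 f (f' x).
Proof.
elim=> [c|||{}f g tf [f' tf' df] tg [g' tg' dg]|{}f g tf [f' tf' df] tg [g' tg' dg]].
- by exists (cst 0); [exact: test_cst|move=> x; exact: is_derive_cst].
- exists (cst (- 2) \* (agnesi_id \* agnesi)); last exact: is_derive_agnesi.
  by apply: test_mul; [exact: test_cst|apply: test_mul; constructor].
- exists (agnesi \+ cst (- 2) \* (agnesi_id \* agnesi_id)).
    apply: test_add; first exact: test_agnesi.
    by apply: test_mul; [exact: test_cst|apply: test_mul; constructor].
  move=> x; apply: is_derive_eq; first exact: is_derive_agnesi_id.
  by rewrite /= expr2; ring.
- by exists (f' \+ g'); [exact: test_add|move=> x; exact: is_deriveD].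
- exists ((f \* g') \+ (g \* f')).
    by apply: test_add; exact: test_mul.
  by move=> x; exact: is_deriveM.
Qed.

Definition poly_antiderivative (p : {poly R}) (c : R) : {poly R} :=
  \poly_(i < (size p).+1) (if i is j.+1 then p`_j / j.+1%:R else c).

Lemma deriv_antiderivative p c : (poly_antiderivative p c)^`() = p.
Proof.
apply/polyP => i; rewrite coef_deriv coef_poly ltnS.
case: ltnP => ip; first by rewrite -[LHS]mulr_natr divfK // pnatr_eq0.
by rewrite mul0rn nth_default.
Qed.

Lemma size_antiderivative p c : (size (poly_antiderivative p c) <= (size p).+1)%N.
Proof. exact: size_poly. Qed.

Lemma horner_antiderivative0 p c : (poly_antiderivative p c).[0] = c.
Proof. by rewrite horner_coef0 coef_poly. Qed.

(** Induction on [l]: integrate the polynomial obtained for [f'], with constant term [f x]. The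
    remainder vanishes at 0 and its derivative is [O(|u| ^ l)], so the mean value theorem gains one
    power. [C] bounds the [l]-th derivative, hence is uniform in [x]. *)
Lemma test_function_taylor (l : nat) f : test_function f ->
  exists2 C, 0 <= C & forall x, exists2 p : {poly R}, (size p <= l)%N &
    forall u, `|f (x + u) - p.[u]| <= C * `|u| ^+ l.
Proof.
elim: l f => [|l IH] f tf.
  have [C C0 fC] := test_function_bounded tf; exists C => // x.
  by exists 0 => [|u]; rewrite ?size_poly0 // horner0 subr0 mulr1.
have [f' tf' df] := test_function_derivative tf.
have [C C0 HC] := IH f' tf'; exists C => // x.
have [q sq Hq] := HC x.
pose p := poly_antiderivative q (f x).
exists p; first exact: leq_trans (size_antiderivative _ _) _.
pose r u := f (x + u) - p.[u].
have r0 : r 0 = 0 by rewrite /r addr0 horner_antiderivative0 subrr.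
have dr (u : R) : is_derive u 1 r (f' (x + u) - q.[u]).
  rewrite -[q in q.[u]](deriv_antiderivative q (f x)).
  apply: is_deriveB.
  have dshift : is_derive u 1 (fun u : R => x + u) 1.
    rewrite (_ : (fun u : R => x + u) = shift x); first exact: is_derive_shift.
    by apply/funext => z; rewrite /= addrC.
  have := @is_derive1_comp _ f (fun u : R => x + u) u _ _ (df (x + u)) dshift.
  by rewrite mulr1.
have cr a b : {within `[a, b], continuous r}.
  by apply: continuous_subspaceT => u; apply: is_derive_continuous (dr u).
(* Common end of the cases [u >= 0] and [u < 0], where [c] is the mean value point between 0 and
   [u]. *)
have key u c : `|c| <= `|u| -> r u - r 0 = (f' (x + c) - q.[c]) * (u - 0) ->
    `|f (x + u) - p.[u]| <= C * `|u| ^+ l.+1.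
  move=> cu; rewrite r0 !subr0 => ru; rewrite -/(r u) ru normrM exprSr mulrA.
  rewrite ler_wpM2r //; apply: le_trans (Hq c) _.
  by rewrite ler_wpM2l // lerXn2r // nnegrE.
move=> u; have [u0|u0] := leP 0 u.
  have [c] := MVT_segment u0 (fun z _ => dr z) (@cr 0 u).
  rewrite in_itv /= => /andP[c0 cu]; apply: key.
  by rewrite !ger0_norm.
have [c] := MVT_segment (ltW u0) (fun z _ => dr z) (@cr u 0).
rewrite in_itv /= => /andP[c0 cu] rE; apply: (key u c).
  by rewrite !ler0_norm ?lerN2 // ltW.
by apply: oppr_inj; rewrite opprB rE -mulrN opprB.
Qed.

End TestFunctions.

(** * The fundamental theorem of calculus on half-lines *)

Section HalfLineFTC.
Context (R : realType).
Local Notation mu := (@lebesgue_measure R).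

Lemma ge0_integral_FTC2y (g G : R -> R) (a L : R) :
  (forall x, 0 <= g x) -> continuous g -> (forall x : R, is_derive x 1 G (g x)) ->
  G x @[x --> +oo] --> L ->
  (\int[mu]_(x in `[a, +oo[) (g x)%:E = (L - G a)%:E)%E.
Proof.
move=> g0 cg dG GL; rewrite (ge0_continuous_FTC2y _ _ GL) ?EFinB //.
- exact: continuous_subspaceT.
- by apply: cvg_at_right_filter; apply: is_derive_continuous (dG a).
- by move=> x _; rewrite derive1E; have [] := dG x.
Qed.

(** Reduces signed integrands to nonnegative ones: [f + g] and [g] are both nonnegative, and their
    integrals are subtracted. *)
Lemma dominated_Rintegral_FTC2y (f F g G : R -> R) (a L M : R) :
  continuous f -> (forall x : R, is_derive x 1 F (f x)) ->
  continuous g -> (forall x : R, is_derive x 1 G (g x)) ->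
  (forall x, `|f x| <= g x) ->
  F x @[x --> +oo] --> L -> G x @[x --> +oo] --> M ->
  \int[mu]_(x in `[a, +oo[) f x = L - F a.
Proof.
move=> cf dF cg dG fg FL GM.
have g0 x : 0 <= g x by exact: le_trans (fg x).
have ig : mu.-integrable `[a, +oo[ (EFin \o g).
  apply/integrableP; split.
    apply/measurable_EFinP; apply: measurable_funTS.
    exact: continuous_measurable_fun.
  under eq_integral do rewrite /= ger0_norm //.
  by rewrite (ge0_integral_FTC2y _ _ _ dG GM) // ltry.
have if_ : mu.-integrable `[a, +oo[ (EFin \o f).
  apply: le_integrable ig => //.
    apply/measurable_EFinP; apply: measurable_funTS.
    exact: continuous_measurable_fun.
  by move=> x _ /=; rewrite lee_fin (ger0_norm (g0 x)).
have H : \int[mu]_(x in `[a, +oo[) (f x + g x) = L + M - (F a + G a).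
  rewrite /Rintegral (@ge0_integral_FTC2y (f \+ g) (F \+ G) a (L + M)) //.
  - by move=> x; have := fg x; rewrite ler_norml /= => /andP[]; lra.
  - by move=> x; apply: cvgD; [exact: cf|exact: cg].
  - exact: cvgD.
have Hg : \int[mu]_(x in `[a, +oo[) g x = M - G a.
  by rewrite /Rintegral (ge0_integral_FTC2y _ _ _ dG GM).
move: H; rewrite RintegralD // Hg => H.
by apply: (addIr (M - G a)); rewrite H; ring.
Qed.

Lemma integrable_agnesi : mu.-integrable setT (EFin \o @agnesi R).
Proof.
have cb : continuous (@agnesi R) by exact: continuous_oneDsqrV.
apply/integrableP; split.
  by apply/measurable_EFinP; exact: continuous_measurable_fun.
under eq_integral do rewrite /= ger0_norm ?(ltW (agnesi_gt0 _)) //.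
rewrite ge0_symfun_integralT //; last 2 first.
- by move=> x; exact/ltW/agnesi_gt0.
- by move=> x; rewrite /agnesi /= sqrrN.
rewrite -set_itvcy (@ge0_integral_FTC2y _ atan 0 (pi / 2)) //.
- by rewrite -EFinM ltry.
- by move=> x; exact/ltW/agnesi_gt0.
- exact: cvgy_atan.
Qed.

End HalfLineFTC.

Section PowerBump.
Context (R : realType) (l : nat).
Local Notation mu := (@lebesgue_measure R).

(** The function [psi] of the overview: it behaves like [x ^+ l] near 0, yet it is bounded and has
    an integrable derivative. *)
Definition power_agnesi (x : R) : R := agnesi_id x ^+ l.
Definition power_agnesi' (x : R) : R :=
  l%:R * agnesi_id x ^+ l.-1 * (agnesi x - 2 * agnesi_id x ^+ 2).

Lemma test_power_agnesi : test_function power_agnesi.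
Proof.
rewrite /power_agnesi; elim: l => [|m IH]; first exact: (test_cst 1).
rewrite (_ : (fun x => _) = @agnesi_id R \* (fun x => agnesi_id x ^+ m)).
  by apply: test_mul; [exact: test_agnesi_id|exact: IH].
by apply/funext => x; rewrite exprS.
Qed.

Lemma is_derive_power_agnesi (x : R) : is_derive x 1 power_agnesi (power_agnesi' x).
Proof.
have := @is_deriveX _ _ (@agnesi_id R) l x 1 _ (is_derive_agnesi_id x).
by rewrite exprfctE.
Qed.

(** Since [0 <= agnesi_id x ^+ 2 <= agnesi x], the last factor of [power_agnesi'] lies between
    [- agnesi x] and [agnesi x]. This makes [psi'] integrable. *)
Lemma power_agnesi'_bound (x : R) : `|power_agnesi' x| <= l%:R * agnesi x.
Proof.
rewrite /power_agnesi' !normrM normr_nat -mulrA ler_wpM2l //.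
have b0 := ltW (agnesi_gt0 x).
apply: le_trans (_ : 1 * agnesi x <= _); last by rewrite mul1r.
apply: ler_pM => //; first by rewrite normrX exprn_ile1 // agnesi_id_le1.
have := agnesi_id_sqr_le x; have := sqr_ge0 (agnesi_id x).
by rewrite ler_norml => h1 h2; apply/andP; split; lra.
Qed.

Lemma continuous_agnesi : continuous (@agnesi R).
Proof. exact: continuous_oneDsqrV. Qed.

Lemma continuous_power_agnesi' : continuous power_agnesi'.
Proof.
move=> x; have cX (m : nat) : {for x, continuous (fun y : R => agnesi_id y ^+ m)}.
  have := @is_deriveX _ _ (@agnesi_id R) m x 1 _ (is_derive_agnesi_id x).
  by rewrite exprfctE => /is_derive_continuous.
apply: cvgM; first by apply: cvgM; [exact: cvg_cst|exact: cX].
apply: cvgB; first exact: continuous_agnesi.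
by apply: cvgM; [exact: cvg_cst|exact: cX].
Qed.

Lemma continuous_power_agnesi : continuous power_agnesi.
Proof.
by move=> x; apply: is_derive_continuous (is_derive_power_agnesi x).
Qed.

Lemma integrable_power_agnesi' : mu.-integrable setT (EFin \o power_agnesi').
Proof.
apply: (le_integrable measurableT _ _
  (integrableZl measurableT l%:R (@integrable_agnesi R))).
  apply/measurable_EFinP; apply: continuous_measurable_fun.
  exact: continuous_power_agnesi'.
move=> x _ /=; rewrite lee_fin (le_trans (power_agnesi'_bound x)) //.
exact: ler_norm.
Qed.

Lemma power_agnesi_le1 (x : R) : `|power_agnesi x| <= 1.
Proof. by rewrite normrX exprn_ile1 // agnesi_id_le1. Qed.

Hypothesis l1 : (1 <= l)%N.

Lemma power_agnesi_cvg0 : power_agnesi x @[x --> +oo] --> 0.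
Proof.
have bnd (x : R) : 0 < x -> `|power_agnesi x| <= x^-1.
  move=> x0; rewrite normrX -(prednK l1) exprS.
  apply: le_trans (_ : x^-1 * 1 <= _); last by rewrite mulr1.
  apply: ler_pM => //; last by rewrite exprn_ile1 // agnesi_id_le1.
  rewrite /agnesi_id normrM gtr0_norm // (gtr0_norm (agnesi_gt0 x)) /agnesi.
  rewrite ler_pdivrMr ?agnesi_den_gt0 // mulrDr mulr1 expr2 mulrA mulVf ?gt_eqF //.
  by rewrite mul1r lerDr invr_ge0 ltW.
apply/cvgr0Pnorm_le => e e0; near=> x.
have xe : e^-1 <= x by near: x; apply: nbhs_pinfty_ge; rewrite num_real.
have x0 : 0 < x by rewrite (lt_le_trans _ xe) // invr_gt0.
by rewrite (le_trans (bnd _ x0)) // invf_ple.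
Unshelve. all: by end_near. Qed.

(** As a function of [y], the indicator is the distribution function of a point mass at [a].
    Integrating distribution functions against [psi'] thus recovers, up to sign, integrals of
    [psi]. *)
Lemma Rintegral_power_agnesi' (a : R) :
  \int[mu]_y (power_agnesi' y * (a <= y)%R%:R) = - power_agnesi a.
Proof.
have <- : \int[mu]_(y in `[a, +oo[) power_agnesi' y = - power_agnesi a.
  rewrite -[RHS]sub0r.
  apply: (@dominated_Rintegral_FTC2y R power_agnesi' power_agnesi
    (fun x => l%:R * agnesi x) (fun x => l%:R * atan x) a 0 (l%:R * (pi / 2))).
  - exact: continuous_power_agnesi'.
  - exact: is_derive_power_agnesi.
  - by move=> x; apply: cvgM; [exact: cvg_cst|exact: continuous_agnesi].
  - exact: power_agnesi'_bound.
  - exact: power_agnesi_cvg0.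
  - by apply: cvgM; [exact: cvg_cst|exact: cvgy_atan].
rewrite [RHS]Rintegral_mkcond; apply: eq_Rintegral => y _.
rewrite patchE mem_setE in_itv /= andbT.
by case: (a <= y); rewrite ?mulr1 ?mulr0.
Qed.

End PowerBump.

(** * Exchange of integrals between a test function and the kernel *)

Section TestAgainstEstimator.
Context (R : realType).
Local Notation mu := (@lebesgue_measure R).
Variables (g K : R -> R).
Hypotheses (ig : mu.-integrable setT (EFin \o g))
  (iK : mu.-integrable setT (EFin \o K)).

Lemma integrable_test_ind (a : R) :
  mu.-integrable setT (EFin \o (fun y => g y * (a <= y)%R%:R)).
Proof.
rewrite (_ : (fun y => _) = fun y => (a <= y)%R%:R * g y); last first.
  by apply/funext => y; rewrite mulrC.
apply: (@integrable_bounded_mul _ g ig _ 1); last first.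
  by move=> y; rewrite normr_nat lern1 leq_b1.
rewrite (_ : (fun y => _) = \1_[set y | a <= y]).
  by apply: measurable_indic; apply: measurable_superlevel; exact: measurable_id.
apply/funext => y; rewrite indicE; congr ((_ : bool)%:R).
by apply/idP/idP; rewrite inE.
Qed.

Section Fubini.
Variables (a h : R).
Let f (z : measurableTypeR R * measurableTypeR R) : \bar R :=
  (g z.1 * ((a + h * z.2 <= z.1)%R%:R * K z.2))%:E.

Let mg : measurable_fun setT g.
Proof. by apply/measurable_EFinP; exact: measurable_int ig. Qed.

Let mK : measurable_fun setT K.
Proof. by apply/measurable_EFinP; exact: measurable_int iK. Qed.

Let mf : measurable_fun setT f.
Proof.
apply/measurable_EFinP; apply: measurable_funM.
  exact: measurableT_comp mg measurable_fst.
apply: measurable_funM; last exact: measurableT_comp mK measurable_snd.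
rewrite (_ : (fun z => _) = \1_[set z : R * R | 0 <= z.1 - (a + h * z.2)]).
  apply: measurable_indic; apply: measurable_superlevel.
  apply: measurable_funB; first exact: measurable_fst.
  apply: measurable_funD; first exact: measurable_cst.
  by apply: measurable_funM; [exact: measurable_cst|exact: measurable_snd].
apply/funext => z; rewrite indicE -subr_ge0; congr ((_ : bool)%:R).
by apply/idP/idP; rewrite inE.
Qed.

(** The integrand is dominated by [|g y| * |K v|], whose double integral is a product of two finite
    integrals. *)
Let if_ : ((mu \x mu)%E).-integrable setT f.
Proof.
apply/integrable12ltyP => //.
have kfin : (\int[mu]_v `|K v|%:E < +oo)%E.
  by have /integrableP[_] := iK.
have gfin : (\int[mu]_v `|g v|%:E < +oo)%E.
  by have /integrableP[_] := ig.
have k0 : (0 <= \int[mu]_v `|K v|%:E)%E.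
  by apply: integral_ge0 => v _; rewrite lee_fin.
apply: (@le_lt_trans _ _ (\int[mu]_y (`|g y|%:E * \int[mu]_v `|K v|%:E))%E).
  apply: ge0_le_integral => //.
  - by move=> y _; exact: integral_ge0.
  - have mabs : measurable_fun setT (abse \o f) by exact: measurableT_comp.
    apply: (@measurable_fun_fubini_tonelli_F _ _ _ _ _ mu (abse \o f) mabs).
    by move=> z; exact: abse_ge0.
  - apply: emeasurable_funM => //; apply/measurable_EFinP.
    exact: measurableT_comp.
  - move=> y _; rewrite -ge0_integralZl_EFin //; last first.
      by apply/measurable_EFinP; exact: measurableT_comp.
    apply: ge0_le_integral => //.
    + apply/measurable_EFinP; apply: measurableT_comp => //.
      rewrite /=; apply: measurable_funM; first exact: measurable_cst.
      by apply: measurable_funM => //; exact: measurable_itvNy_ind.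
    + apply: measurable_funeM; apply/measurable_EFinP.
      exact: measurableT_comp.
    + move=> v _; rewrite /f /= -EFinM lee_fin !normrM ler_wpM2l //.
      by rewrite normr_nat ler_piMl // lern1 leq_b1.
rewrite ge0_integralZr //; last first.
  by apply/measurable_EFinP; exact: measurableT_comp.
have g0 : (0 <= \int[mu]_v `|g v|%:E)%E.
  by apply: integral_ge0 => v _; rewrite lee_fin.
by rewrite lte_mul_pinfty // ge0_fin_numE.
Qed.

Let fE (y : R) : (\int[mu]_v f (y, v))%E =
  (g y * \int[mu]_v ((a + h * v <= y)%R%:R * K v))%:E.
Proof.
rewrite /f /=; under eq_integral do rewrite EFinM.
have iI := integrable_itvNy_ind iK a h y.
rewrite (integralZl measurableT iI) EFinM; congr (_ * _)%E.
by rewrite /Rintegral fineK //; exact: integrable_fin_num iI.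
Qed.

Lemma integrable_test_smoothed_ind : mu.-integrable setT
  (EFin \o (fun y => g y * \int[mu]_v ((a + h * v <= y)%R%:R * K v))).
Proof.
apply: (eq_integrable _ (fubini_F mu f)) => //; last exact: integrable_fubini_F.
by move=> y _; rewrite /fubini_F fE.
Qed.

Lemma Rintegral_test_smoothed_ind :
  \int[mu]_y (g y * \int[mu]_v ((a + h * v <= y)%R%:R * K v)) =
  \int[mu]_v ((\int[mu]_y (g y * (a + h * v <= y)%R%:R)) * K v).
Proof.
rewrite /Rintegral; congr fine.
transitivity (\int[mu]_y \int[mu]_v f (y, v))%E.
  by apply: eq_integral => y _; rewrite fE.
rewrite Fubini //; apply: eq_integral => v _; rewrite /f /=.
have iI := integrable_test_ind (a + h * v).
under eq_integral do rewrite mulrA EFinM.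
rewrite (integralZr measurableT iI) EFinM; congr (_ * _)%E.
by rewrite /Rintegral fineK //; exact: integrable_fin_num iI.
Qed.

End Fubini.
End TestAgainstEstimator.

Section TestEstimator.
Context (R : realType) (l : nat) (K : R -> R).
Local Notation mu := (@lebesgue_measure R).
Local Notation psi := (@power_agnesi R l).
Local Notation psi' := (@power_agnesi' R l).

Lemma integrable_psi (z t : R) :
  mu.-integrable setT (EFin \o K) ->
  mu.-integrable setT (EFin \o (fun u => psi (z + t * u) * K u)).
Proof.
move=> iK; apply: (@integrable_bounded_mul _ K iK _ 1); last first.
  by move=> v; exact: power_agnesi_le1.
apply: measurableT_comp.
  by apply: continuous_measurable_fun; exact: continuous_power_agnesi.
by apply: measurable_funD; [exact: measurable_cst|
  apply: measurable_funM; [exact: measurable_cst|exact: measurable_id]].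
Qed.

(** The average on the left equals the integral of [psi' * (F_n - F_{n,h})], by the representation
    of [psi] through [psi'] and Fubini. *)
Lemma test_estimator_bound (x : nat -> R) (n : nat) (h D : R) : (1 <= l)%N ->
  mu.-integrable setT (EFin \o K) -> 0 < h ->
  (forall y, `|empirical_df x n y - kernel_df_estimator K x n h y| <= D) ->
  `|n%:R^-1 * \sum_(i < n) (\int[mu]_v (psi (x i + h * v) * K v) - psi (x i))|
  <= D * \int[mu]_y `|psi' y|.
Proof.
move=> l1 iK h0 FD; have ig := @integrable_power_agnesi' R l.
pose S i y := \int[mu]_v ((x i + h * v <= y)%R%:R * K v).
pose e i y := psi' y * (x i <= y)%R%:R - psi' y * S i y.
have i1 i : mu.-integrable setT (EFin \o (fun y => psi' y * (x i <= y)%R%:R)).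
  exact: integrable_test_ind ig _.
have i2 i : mu.-integrable setT (EFin \o (fun y => psi' y * S i y)).
  exact: integrable_test_smoothed_ind ig iK _ _.
have ie i : mu.-integrable setT (EFin \o e i).
  exact: (integrableB measurableT (i1 i) (i2 i)).
have eE i : \int[mu]_y e i y = \int[mu]_v (psi (x i + h * v) * K v) - psi (x i).
  rewrite RintegralB // Rintegral_power_agnesi' // Rintegral_test_smoothed_ind //.
  rewrite addrC; congr (_ - _).
  have ip := integrable_psi (x i) h iK.
  transitivity (- \int[mu]_v ((-1) * (psi (x i + h * v) * K v))).
    congr (- _); apply: eq_Rintegral => v _.
    by rewrite Rintegral_power_agnesi' // mulN1r mulNr.
  by rewrite RintegralZl // mulN1r opprK.
have isum : mu.-integrable setT (EFin \o (fun y => \sum_(i < n) e i y)).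
  exact: integrable_Rsum.
rewrite -(eq_bigr _ (fun (i : 'I_n) _ => eE i)) -Rintegral_sum //.
rewrite -[X in `|X|]RintegralZl //.
have is' : mu.-integrable setT (EFin \o (fun y => n%:R^-1 * \sum_(i < n) e i y)).
  exact: (integrableZl measurableT n%:R^-1 isum).
apply: (le_trans (le_normr_Rintegral _ _)) => //.
rewrite -RintegralZl //; last exact: integrable_norm.
apply: le_Rintegral => //.
- exact: integrable_norm.
- exact: (integrableZl measurableT D (integrable_norm ig)).
move=> y _.
have -> : n%:R^-1 * \sum_(i < n) e i y =
    psi' y * (empirical_df x n y - kernel_df_estimator K x n h y).
  rewrite kernel_df_estimatorE // /empirical_df -mulrBr -sumrB [RHS]mulrCA [in RHS]mulr_sumr.
  by congr (_ * _); apply: eq_bigr => i _; rewrite mulrBr.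
by rewrite normrM mulrC ler_wpM2r.
Qed.

Section Kernel.
Hypothesis hK : is_kernel l K.
Let k : R := \int[mu]_u (u ^+ l * K u).

Lemma kernel_order_ge1 : (1 <= l)%N.
Proof. by case: hK. Qed.

Lemma kernel_moment_integrable j : (j <= l)%N ->
  mu.-integrable setT (EFin \o (fun u => u ^+ j * K u)).
Proof. by case: hK => _ H _ _ _; exact: H. Qed.

Lemma kernel_integrable : mu.-integrable setT (EFin \o K).
Proof.
have := @kernel_moment_integrable 0 (leq0n l).
by apply: eq_integrable => // u _; rewrite /= expr0 mul1r.
Qed.

Lemma kernel_poly_integrable (p : {poly R}) : (size p <= l.+1)%N ->
  mu.-integrable setT (EFin \o (fun u => p.[u] * K u)).
Proof.
move=> sp; rewrite (_ : (fun u => _) =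
    fun u => \sum_(i < l.+1) p`_i * (u ^+ i * K u)); last first.
  apply/funext => u; rewrite (horner_coef_wide _ sp) mulr_suml.
  by apply: eq_bigr => i _; rewrite mulrA.
apply: (@integrable_Rsum _ l.+1 (fun i u => p`_i * (u ^+ i * K u))) => i.
exact: (integrableZl measurableT p`_i (@kernel_moment_integrable i (ltn_ord i))).
Qed.

(** Among the moments of order at most [l], the zeroth is 1 and those strictly between 0 and [l]
    vanish. *)
Lemma kernel_poly_integral (p : {poly R}) : (size p <= l.+1)%N ->
  \int[mu]_u (p.[u] * K u) = p`_0 + p`_l * k.
Proof.
move=> sp.
transitivity (\sum_(i < l.+1) p`_i * \int[mu]_u (u ^+ i * K u)).
  transitivity (\int[mu]_u (\sum_(i < l.+1) p`_i * (u ^+ i * K u))).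
    apply: eq_Rintegral => u _; rewrite (horner_coef_wide _ sp) mulr_suml.
    by apply: eq_bigr => i _; rewrite mulrA.
  rewrite (@Rintegral_sum _ l.+1 (fun i u => p`_i * (u ^+ i * K u))); last first.
    move=> i; exact: (integrableZl measurableT p`_i
      (@kernel_moment_integrable i (ltn_ord i))).
  apply: eq_bigr => i _; rewrite RintegralZl //.
  exact: (@kernel_moment_integrable i (ltn_ord i)).
have [l1 _ K1 Kmid _] := hK.
rewrite big_ord_recr /= -/k; congr (_ + _).
case: l l1 Kmid => [//|m] _ Kmid.
rewrite big_ord_recl /= big1 => [|i _]; last by rewrite Kmid ?mulr0 // ltnS ltn_ord.
rewrite addr0 -[RHS]mulr1 -K1; congr (_ * _).
by apply: eq_Rintegral => u _; rewrite expr0 mul1r.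
Qed.

Lemma kernel_abs_moment_integrable j : (j <= l)%N ->
  mu.-integrable setT (EFin \o (fun u => `|u| ^+ j * `|K u|)).
Proof.
move=> /kernel_moment_integrable /integrable_norm.
by apply: eq_integrable => // u _ /=; rewrite normrM normrX.
Qed.

(** The Taylor polynomial of degree less than [l] integrates against [K] to its constant term
    [psi z]; the remainder is at most a multiple of [t ^ l * |u| ^ l], which is integrable against
    [|K|]. *)
Lemma smoothing_error_bounded : exists2 C : R, 0 <= C & forall z t : R, 0 < t ->
  `|\int[mu]_u (psi (z + t * u) * K u) - psi z| <= t ^+ l * C.
Proof.
have [C C0 HC] := test_function_taylor l (@test_power_agnesi R l).
have iabs := kernel_abs_moment_integrable (leqnn l).
exists (C * \int[mu]_u (`|u| ^+ l * `|K u|)) => [|z t t0].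
  by rewrite mulr_ge0 // Rintegral_ge0.
have [p sp Hp] := HC z.
have l1 := kernel_order_ge1.
(* The Taylor estimate at [u = 0], where [l >= 1] makes the right side 0. *)
have p0 : p`_0 = psi z.
  apply/eqP; rewrite eq_sym -subr_eq0 -normr_le0 -horner_coef0.
  have := Hp 0; rewrite addr0 normr0 expr0n.
  by rewrite eqn0Ngt l1 mulr0.
pose q := \poly_(i < l) (p`_i * t ^+ i).
have sq : (size q <= l)%N by exact: size_poly.
have qE u : q.[u] = p.[t * u].
  rewrite horner_poly (horner_coef_wide _ sp).
  by apply: eq_bigr => i _; rewrite exprMn mulrA.
have iq := @kernel_poly_integrable q (leqW sq).
have iqK : \int[mu]_u (q.[u] * K u) = psi z.
  rewrite kernel_poly_integral ?(leqW sq) // !coef_poly ltnn mul0r addr0 l1.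
  by rewrite expr0 mulr1.
rewrite -[X in _ - X]iqK -RintegralB //; last first.
  exact: integrable_psi kernel_integrable.
have iB : mu.-integrable setT
    (EFin \o (fun u => psi (z + t * u) * K u - q.[u] * K u)).
  exact: (integrableB measurableT (integrable_psi z t kernel_integrable) iq).
apply: (le_trans (le_normr_Rintegral _ _)) => //.
rewrite mulrA -RintegralZl //; apply: le_Rintegral => //.
- exact: integrable_norm.
- exact: (integrableZl measurableT (t ^+ l * C) iabs).
move=> u _; rewrite -mulrBl normrM mulrA ler_wpM2r // qE.
apply: le_trans (Hp (t * u)) _.
by rewrite normrM exprMn (gtr0_norm t0) mulrA [C * _]mulrC.
Qed.

End Kernel.
End TestEstimator.

(** * The leading term of the smoothing error and the exclusion of large bandwidths *)

Section Separation.
Context (R : realType) (l : nat) (K : R -> R).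
Local Notation mu := (@lebesgue_measure R).
Local Notation psi := (@power_agnesi R l).
Hypothesis hK : is_kernel l K.
Let k : R := \int[mu]_u (u ^+ l * K u).

Lemma agnesi_antitone (x y : R) : `|x| <= `|y| -> agnesi y <= agnesi x.
Proof.
move=> xy; rewrite /agnesi lef_pV2 ?posrE ?agnesi_den_gt0 // lerD2l.
by rewrite -(real_normK (num_real x)) -(real_normK (num_real y)) lerXn2r ?nnegrE.
Qed.

Lemma power_agnesi_scaled (t y : R) :
  psi (t * y) = t ^+ l * (y ^+ l * agnesi (t * y) ^+ l).
Proof. by rewrite /power_agnesi /agnesi_id !exprMn mulrA. Qed.

(** Both [|y| ^ l] and [1 - agnesi (t * y) ^+ l] are nondecreasing in [|y|]. *)
Lemma power_defect_le (t y Y : R) : `|y| <= Y ->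
  `|y ^+ l * agnesi (t * y) ^+ l - y ^+ l| <=
  Y ^+ l * (1 - agnesi (t * Y) ^+ l).
Proof.
move=> yY; have Y0 : 0 <= Y by exact: le_trans yY.
have a0 (z : R) : 0 <= agnesi z ^+ l by rewrite exprn_ge0 // ltW // agnesi_gt0.
have a1 (z : R) : agnesi z ^+ l <= 1.
  by rewrite exprn_ile1 // ?agnesi_le1 // ltW // agnesi_gt0.
rewrite -[X in _ - X]mulr1 -mulrBr normrM distrC [X in _ * X]ger0_norm ?subr_ge0 //.
apply: ler_pM; rewrite ?subr_ge0 //.
  by rewrite normrX lerXn2r // nnegrE.
have ag0 (z : R) : 0 <= agnesi z by exact/ltW/agnesi_gt0.
rewrite lerB // lerXn2r ?nnegrE //.
by apply: agnesi_antitone; rewrite !normrM ler_wpM2l // (ger0_norm Y0).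
Qed.

(** Bounding the sum by twice the larger term gives [(M + |u|) ^ l <= 2 ^ l * (M ^ l + |u| ^ l)]. *)
Lemma shifted_power_integrable (M : R) : 0 <= M ->
  mu.-integrable setT (EFin \o (fun u => (M + `|u|) ^+ l * `|K u|)).
Proof.
move=> M0; have iK := kernel_integrable hK.
have i0 := integrableZl measurableT (2 ^+ l * M ^+ l) (integrable_norm iK).
have i1 := integrableZl measurableT (2 ^+ l)
  (kernel_abs_moment_integrable hK (leqnn l)).
apply: (le_integrable measurableT _ _ (integrableD measurableT i0 i1)).
  apply/measurable_EFinP; apply: measurable_funM.
    apply: measurable_funX; apply: measurable_funD; first exact: measurable_cst.
    exact: normr_measurable.
  by apply: measurableT_comp => //; apply/measurable_EFinP; exact: measurable_int iK.
move=> u _; rewrite /= lee_fin.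
rewrite [leRHS]ger0_norm; last by rewrite addr_ge0 // !mulr_ge0 // exprn_ge0.
rewrite ger0_norm; last by rewrite mulr_ge0 // exprn_ge0 // addr_ge0.
rewrite -mulrA -mulrDr -mulrDl mulrA ler_wpM2r //.
have [Mu|uM] := leP M `|u|.
  apply: (@le_trans _ _ ((2 * `|u|) ^+ l)).
    by rewrite lerXn2r ?nnegrE ?addr_ge0 ?mulr_ge0 //; lra.
  by rewrite exprMn ler_wpM2l ?exprn_ge0 // lerDr exprn_ge0.
apply: (@le_trans _ _ ((2 * M) ^+ l)).
  by rewrite lerXn2r ?nnegrE ?addr_ge0 ?mulr_ge0 //; lra.
by rewrite exprMn ler_wpM2l ?exprn_ge0 // lerDl exprn_ge0.
Qed.

(** A majorant, uniform in [|z| <= M], of the error made under the integral when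
    [psi (t * (z + u)) / t ^ l] is replaced by [(z + u) ^ l]. *)
Let defect (M t u : R) : R :=
  (M + `|u|) ^+ l * (1 - agnesi (t * (M + `|u|)) ^+ l) * `|K u|.

Let defect_bounds M t u : 0 <= M ->
  0 <= defect M t u <= (M + `|u|) ^+ l * `|K u|.
Proof.
move=> M0; rewrite /defect.
have a1 (z : R) : 0 <= 1 - agnesi z ^+ l <= 1.
  have a0 := ltW (agnesi_gt0 z).
  by rewrite subr_ge0 exprn_ile1 ?agnesi_le1 //= gerBl exprn_ge0.
have /andP[h0 h1] := a1 (t * (M + `|u|)).
have Mu : 0 <= (M + `|u|) ^+ l by rewrite exprn_ge0 // addr_ge0.
by rewrite !mulr_ge0 //= ler_wpM2r // ler_piMr.
Qed.

Let defect_integrable M t : 0 <= M -> mu.-integrable setT (EFin \o defect M t).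
Proof.
move=> M0; apply: (le_integrable measurableT _ _ (shifted_power_integrable M0)).
  have mM : measurable_fun setT (fun u : R => M + `|u|).
    apply: measurable_funD; first exact: measurable_cst.
    exact: normr_measurable.
  apply/measurable_EFinP; apply: measurable_funM.
    apply: measurable_funM; first exact: measurable_funX.
    apply: measurable_funB; first exact: measurable_cst.
    apply: measurable_funX; apply: (measurableT_comp (f := @agnesi R)).
      by apply: continuous_measurable_fun; exact: continuous_agnesi.
    by apply: measurable_funM => //; exact: measurable_cst.
  apply: measurableT_comp => //; apply/measurable_EFinP.
  exact: measurable_int (kernel_integrable hK).
move=> u _; have /andP[d0 d1] := defect_bounds t u M0.
rewrite /= lee_fin ger0_norm // ger0_norm //.
exact: le_trans d1.
Qed.

Let defect_cvg0 M : 0 <= M ->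
  \int[mu]_u defect M m.+1%:R^-1 u @[m --> \oo] --> (0 : R).
Proof.
move=> M0.
have [|||||] := @dominated_convergence _ _ _ mu setT measurableT
  (fun m u => (defect M m.+1%:R^-1 u)%:E) (cst 0%E)
  (fun u => ((M + `|u|) ^+ l * `|K u|)%:E).
- by move=> m; exact: measurable_int (defect_integrable m.+1%:R^-1 M0).
- exact: measurable_cst.
- apply: aeW => u _; apply: cvg_EFin; first exact: nearW.
  have ca : agnesi (m.+1%:R^-1 * (M + `|u|)) @[m --> \oo] --> (1 : R).
    have {2}-> : 1 = agnesi (0 * (M + `|u|)) :> R.
      by rewrite mul0r /agnesi expr0n addr0 invr1.
    apply: continuous_cvg; first exact: continuous_agnesi.
    by apply: cvgM; [exact: cvg_harmonic|exact: cvg_cst].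
  have cal : agnesi (m.+1%:R^-1 * (M + `|u|)) ^+ l @[m --> \oo] --> (1 : R).
    have := cvg_comp _ _ ca (@exprn_continuous R l 1).
    by rewrite expr1n.
  rewrite /defect -(mul0r `|K u|) -(mulr0 ((M + `|u|) ^+ l)) -(subrr 1).
  apply: cvgM; last exact: cvg_cst.
  apply: cvgM; first exact: cvg_cst.
  by apply: cvgB; [exact: cvg_cst|exact: cal].
- exact: shifted_power_integrable.
- apply: aeW => u m _; have /andP[d0 d1] := defect_bounds m.+1%:R^-1 u M0.
  by rewrite /= lee_fin ger0_norm.
- by move=> _ _; rewrite integral0 => /fine_cvg.
Qed.

Lemma kernel_abs_ge1 : 1 <= \int[mu]_u `|K u|.
Proof.
have [_ _ K1 _ _] := hK; rewrite -K1; apply: le_trans (ler_norm _) _.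
exact: le_normr_Rintegral (kernel_integrable hK).
Qed.

(** After division by [t ^ l], [psi (t * y)] becomes [rho y], close to [y ^ l]. For [y ^ l] itself
    the smoothing error is exactly [k]; the replacement costs [e / 2] under the integral and [e / 2]
    at [z]. *)
Lemma smoothing_error_local (M e : R) : 0 <= M -> 0 < e ->
  exists2 t : R, 0 < t & forall z, `|z| <= M ->
    `|\int[mu]_u (psi (t * z + t * u) * K u) - psi (t * z) - t ^+ l * k| <=
    t ^+ l * e.
Proof.
move=> M0 e0; have e2 : 0 < e / 2 by rewrite divr_gt0.
have /cvgr0Pnorm_lt /(_ _ e2) /(@filter_ex _ _ _) [m] := defect_cvg0 M0.
set t := m.+1%:R^-1; have t0 : 0 < t by rewrite invr_gt0.
move=> hm; exists t => // z zM.
have id := defect_integrable t M0.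
have {}hm : \int[mu]_u defect M t u <= e / 2.
  by rewrite ltW // (le_lt_trans (ler_norm _)).
pose rho y := y ^+ l * agnesi (t * y) ^+ l.
have iK := kernel_integrable hK.
have irho : mu.-integrable setT (EFin \o (fun u => rho (z + u) * K u)).
  have := integrableZl measurableT (t ^- l) (integrable_psi l (t * z) t iK).
  apply: eq_integrable => // u _ /=; rewrite -EFinM; congr EFin.
  by rewrite -mulrDr power_agnesi_scaled !mulrA mulVf ?mul1r // expf_neq0 // gt_eqF.
have psiE : \int[mu]_u (psi (t * z + t * u) * K u) =
    t ^+ l * \int[mu]_u (rho (z + u) * K u).
  rewrite -RintegralZl //; apply: eq_Rintegral => u _.
  by rewrite -mulrDr power_agnesi_scaled -mulrA.
(* The polynomial [(z + u) ^ l] in [u]: monic of degree [l] with constant term [z ^ l], so its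
   integral against [K] is [z ^ l + k]. *)
pose p : {poly R} := ('X - (- z)%:P) ^+ l.
have sp : size p = l.+1 by rewrite /p size_exp_XsubC.
have pE u : p.[u] = (z + u) ^+ l.
  by rewrite /p horner_exp hornerXsubC opprK addrC.
have ip := kernel_poly_integrable hK (eq_leq sp).
have pK : \int[mu]_u (p.[u] * K u) = z ^+ l + k.
  rewrite (kernel_poly_integral hK) ?sp // -horner_coef0 pE addr0.
  have -> : p`_l = 1.
    have := monic_exp l (monicXsubC (- z)); rewrite -/p => /monicP.
    by rewrite lead_coefE sp.
  by rewrite mul1r.
rewrite psiE power_agnesi_scaled -/(rho z) -!mulrBr normrM.
rewrite (ger0_norm (exprn_ge0 l (ltW t0))) ler_wpM2l ?(exprn_ge0 l (ltW t0)) //.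
have -> : \int[mu]_u (rho (z + u) * K u) - rho z - k =
    (\int[mu]_u (rho (z + u) * K u) - \int[mu]_u (p.[u] * K u)) - (rho z - z ^+ l).
  by rewrite pK; ring.
rewrite -RintegralB // (splitr e); apply: le_trans (ler_normB _ _) _; apply: lerD.
  have iB : mu.-integrable setT (EFin \o (fun u => rho (z + u) * K u - p.[u] * K u)).
    exact: (integrableB measurableT irho ip).
  apply: le_trans (le_normr_Rintegral measurableT iB) _.
  apply: le_trans hm; apply: le_Rintegral => //; first exact: integrable_norm.
  move=> u _; rewrite -mulrBl normrM ler_wpM2r // pE.
  by apply: power_defect_le; rewrite (le_trans (ler_normD _ _)) // lerD2r.
(* The pointwise error at [z] is also below the integral of [defect]: enlarge [|z|] to [M], multiply
   by the integral of [|K|], which is at least 1, then enlarge [M] to [M + |u|]. *)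
apply: le_trans (power_defect_le t zM) _; apply: le_trans hm.
have D0 : 0 <= M ^+ l * (1 - agnesi (t * M) ^+ l).
  by apply: le_trans (power_defect_le t zM).
apply: le_trans (ler_peMr D0 kernel_abs_ge1) _.
rewrite -RintegralZl //; last exact: integrable_norm.
apply: le_Rintegral => //.
  exact: (integrableZl measurableT _ (integrable_norm iK)).
move=> u _; rewrite /defect ler_wpM2r //.
have Mu : `|M| <= M + `|u| by rewrite ger0_norm // lerDl.
have a0 (y : R) : 0 <= agnesi y by exact/ltW/agnesi_gt0.
apply: ler_pM; rewrite ?exprn_ge0 ?subr_ge0 ?exprn_ile1 ?agnesi_le1 //.
  by rewrite lerXn2r ?nnegrE ?addr_ge0 // lerDl.
rewrite lerB // lerXn2r ?nnegrE //.
apply: agnesi_antitone; rewrite !normrM ler_wpM2l //.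
by rewrite [leRHS]ger0_norm // addr_ge0.
Qed.

End Separation.

(* At scale [t / h] the sample and the bandwidth become [t * x i / h] and [t];
   the test function then separates the two distribution functions by the
   leading term [t ^+ l * k] of the smoothing error, uniformly in [h >= h0]. *)
Lemma estimator_separation (R : realType) (l : nat) (K : R -> R) :
  is_kernel l K -> exists2 theta : R, 0 < theta &
  forall h0 M : R, 0 < h0 -> 0 <= M -> exists2 delta : R, 0 < delta &
  forall (n : nat) (x : nat -> R) (h : R), (0 < n)%N -> h0 <= h ->
    \sum_(i < n) (M < `|x i|)%R%:R <= theta * n%:R ->
    exists t, delta <= `|empirical_df x n t - kernel_df_estimator K x n h t|.
Proof.
move=> hK; have [l1 _ _ _ k_neq0] := hK; have iK := kernel_integrable hK.
set mu := @lebesgue_measure R in k_neq0 *.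
set k : R := \int[mu]_u (u ^+ l * K u) in k_neq0 *.
have k0 : 0 < `|k| by rewrite normr_gt0.
have [C C0 HC] := smoothing_error_bounded hK.
have kC : 0 < `|k| + C by rewrite ltr_pwDl.
(* A fraction [theta] of observations outside [[-M, M]], each with error at most
   [t ^ l * (|k| + C)], contributes at most [t ^ l * |k| / 4] to the mean. *)
pose theta := `|k| / (4 * (`|k| + C)).
exists theta => [|h0 M h00 M0]; first by rewrite divr_gt0 // mulr_gt0.
(* The radius [M / h0] covers [x i / h] for every [|x i| <= M] and [h >= h0], so [t] does not depend
   on [h]. *)
have [t t0 Ht] := @smoothing_error_local _ _ _ hK (M / h0) (`|k| / 4)
  (divr_ge0 M0 (ltW h00)) (divr_gt0 k0 (ltr0n _ 4)).
pose J := \int[mu]_y `|power_agnesi' l y|.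
have J0 : 0 <= J by exact: Rintegral_ge0.
have tl0 : 0 < t ^+ l by rewrite exprn_gt0.
(* Dividing by [J + 1] keeps [delta * J] strictly below [t ^ l * |k| / 2], the lower bound on [|A|]
   that yields the contradiction. *)
pose delta := t ^+ l * (`|k| / 2) / (J + 1).
have J1 : 0 < J + 1 by rewrite ltr_wpDl.
exists delta => [|n x h n0 h0h bad]; first by rewrite divr_gt0 // mulr_gt0 // divr_gt0.
have hp : 0 < h by exact: lt_le_trans h0h.
have N0 : 0 < n%:R :> R by rewrite ltr0n.
apply: contrapT => /forallNP small.
pose x' i := t * (x i / h).
have scale y i v : (x' i + t * v <= y) = (x i + h * v <= h * (y / t)).
  rewrite /x' -mulrDr mulrC -ler_pdivlMr // -(ler_pM2l hp) mulrDr.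
  by rewrite mulrCA divff ?mulr1 // gt_eqF.
have FD y : `|empirical_df x' n y - kernel_df_estimator K x' n t y| <= delta.
  have -> : empirical_df x' n y = empirical_df x n (h * (y / t)).
    congr (_ * _); apply: eq_bigr => i _; congr ((_ : bool)%:R).
    by have := scale y i 0; rewrite !mulr0 !addr0.
  have -> : kernel_df_estimator K x' n t y = kernel_df_estimator K x n h (h * (y / t)).
    rewrite !kernel_df_estimatorE //; congr (_ * _); apply: eq_bigr => i _.
    by apply: eq_Rintegral => v _; rewrite scale.
  by rewrite leNgt; apply/negP => /ltW /small.
pose b i := \int[mu]_v (power_agnesi l (x' i + t * v) * K v) - power_agnesi l (x' i).
pose A := n%:R^-1 * \sum_(i < n) b i.
have AJ : `|A| <= delta * J := test_estimator_bound l1 iK t0 FD.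
have bi i : `|b i - t ^+ l * k| <=
    t ^+ l * (`|k| / 4) + t ^+ l * (`|k| + C) * (M < `|x i|)%R%:R.
  have [xM|Mx] := leP `|x i| M.
    rewrite mulr0 addr0; apply: Ht.
    rewrite normrM normfV (gtr0_norm hp); apply: ler_pM => //.
      by rewrite invr_ge0 ltW.
    by rewrite lef_pV2 ?posrE.
  rewrite mulr1; apply: ler_wpDl; first by rewrite mulr_ge0 ?(ltW tl0) // divr_ge0.
  apply: le_trans (ler_normB _ _) _; rewrite normrM (gtr0_norm tl0) mulrDr addrC.
  by rewrite lerD2l; exact: HC.
have Ak : `|A - t ^+ l * k| <= t ^+ l * (`|k| / 2).
  have -> : A - t ^+ l * k = n%:R^-1 * \sum_(i < n) (b i - t ^+ l * k).
    rewrite sumrB sumr_const card_ord mulrBr -[(t ^+ l * k) *+ n]mulr_natl.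
    by rewrite mulKf // gt_eqF.
  rewrite normrM gtr0_norm ?invr_gt0 // mulrC ler_pdivrMr //.
  apply: le_trans (ler_norm_sum _ _ _) _.
  apply: (@le_trans _ _ (\sum_(i < n) (t ^+ l * (`|k| / 4) +
      t ^+ l * (`|k| + C) * (M < `|x i|)%R%:R))).
    by apply: ler_sum => i _; exact: bi.
  rewrite big_split /= sumr_const card_ord -mulr_sumr -[_ *+ n]mulr_natr.
  apply: (@le_trans _ _ (t ^+ l * (`|k| / 4) * n%:R +
      t ^+ l * (`|k| + C) * (theta * n%:R))).
    by rewrite lerD2l ler_wpM2l // mulr_ge0 ?(ltW tl0) // ltW.
  suff -> : t ^+ l * (`|k| + C) * (theta * n%:R) = t ^+ l * (`|k| / 4) * n%:R.
    by rewrite -mulrDl -mulrDr ler_wpM2r // ler_wpM2l ?(ltW tl0) //; lra.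
  by rewrite /theta; field; rewrite gt_eqF.
have : t ^+ l * (`|k| / 2) <= `|A|.
  have : `|t ^+ l * k| <= `|A - t ^+ l * k| + `|A|.
    rewrite -[X in `|X| <= _](subrK A) (le_trans (ler_normD _ _)) //.
    by rewrite lerD2r distrC.
  rewrite normrM (gtr0_norm tl0) => h1.
  have : t ^+ l * `|k| <= t ^+ l * (`|k| / 2) + `|A|.
    by rewrite (le_trans h1) // lerD2r.
  have {1}-> : `|k| = `|k| / 2 + `|k| / 2 by lra.
  by rewrite mulrDr lerD2l.
move=> /le_trans /(_ AJ); rewrite /delta -mulrA ler_pMr ?mulr_gt0 ?divr_gt0 //.
by rewrite mulrC ler_pdivlMr // mul1r; apply/negP; rewrite -ltNge ltrDl.
Qed.

(** * Convergence of the bandwidth and the L1 lower bound *)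

Lemma empirical_df_cvg0 (R : realType) (x : nat -> R) (n : nat) :
  empirical_df x n (- m%:R) @[m --> \oo] --> (0 : R).
Proof.
suff : n%:R^-1 * (\sum_(i < n) (x i <= - m%:R)%R%:R)
    @[m --> \oo] --> n%:R^-1 * (\sum_(i < n) (0 : R)).
  by rewrite big1 // mulr0.
apply: cvgM; first exact: cvg_cst.
apply: cvg_big; first exact: add_continuous.
move=> i _; apply: cvg_near_cst; near=> m.
rewrite leNgt (_ : _ < _) // ltrNl; near: m; exact: nbhs_infty_gtr.
Unshelve. all: by end_near. Qed.

(** One increment from a point far to the left up to [t] recovers [F t - G t] up to an arbitrarily
    small error. *)
Lemma d_kuip_uniform (R : realType) (F G : R -> R) (k : nat) (s : R) :
  (1 <= k)%N -> (F (- m%:R) - G (- m%:R)) @[m --> \oo] --> (0 : R) ->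
  (d_kuip k F G <= s%:E)%E -> forall t, `|F t - G t| <= s.
Proof.
case: k => [//|k] _ FG0 ds t; apply/ler_addgt0Pr => e e0.
have [m [mt me]] : exists m : nat, - m%:R <= t /\ `|F (- m%:R) - G (- m%:R)| <= e.
  suff : \forall m \near \oo, - m%:R <= t /\ `|F (- m%:R) - G (- m%:R)| <= e.
    by move=> /(@filter_ex _ _ _).
  near=> m; split.
    by rewrite lerNl; near: m; exact: nbhs_infty_ger.
  by near: m; move/cvgr0Pnorm_le : FG0 => /(_ e e0).
(* All remaining intervals degenerate to the point [t] and contribute 0. *)
pose a (i : 'I_k.+1) : R := if i == ord0 then - m%:R else t.
have : `|F t - F (- m%:R) - (G t - G (- m%:R))| <= s.
  rewrite -lee_fin; apply: le_trans ds; apply: ereal_sup_ubound.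
  exists a, (fun=> t); split.
  - by move=> i; rewrite /a; case: ifP.
  - by move=> i j ij; rewrite /a; case: eqP ij => // ->.
  - rewrite big_ord_recl /= /a eqxx big1 ?addr0 // => i _.
    by rewrite !subrr normr0.
move=> h; have -> : F t - G t = F t - F (- m%:R) - (G t - G (- m%:R)) +
    (F (- m%:R) - G (- m%:R)) by ring.
by rewrite (le_trans (ler_normD _ _)) // lerD.
Unshelve. all: by end_near. Qed.

Lemma d_infty_uniform (R : realType) (F G : R -> R) (s : R) :
  (d_infty F G <= s%:E)%E -> forall t, `|F t - G t| <= s.
Proof.
by move=> ds t; rewrite -lee_fin; apply: le_trans ds; apply: ereal_sup_ubound; exists t.
Qed.

Lemma cvg_powRN (R : realType) (a : R) : 0 < a -> n%:R `^ (- a) @[n --> \oo] --> (0 : R).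
Proof.
move=> a0; apply/cvgr0Pnorm_le => e e0; near=> n.
have n1 : (0 < n)%N by near: n; exact: nbhs_infty_gt.
rewrite ger0_norm ?powR_ge0 // powRN invf_ple ?posrE ?powR_gt0 ?ltr0n //.
have -> : e^-1 = (e^-1 `^ a^-1) `^ a.
  by rewrite -powRrM mulVf ?gt_eqF // powRr1 // invr_ge0 ltW.
apply: ge0_ler_powR; rewrite ?nnegrE ?powR_ge0 ?(ltW a0) //.
near: n; exact: nbhs_infty_ger.
Unshelve. all: by end_near. Qed.

(** The deterministic core, for one fixed sample path: first [H n < h0] eventually, then the bias
    condition bounds [n * H n]. *)
Lemma bandwidth_collapse (R : realType) (l : nat) (K : R -> R)
    (Q : probability R R) (s : nat -> R) (eps delta c h0 : R)
    (x : nat -> R) (H : nat -> R) :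
  is_kernel l K -> 0 < eps -> eps < delta -> delta < 1 -> 0 < c -> 0 < h0 ->
  (n%:R `^ eps * s n) @[n --> \oo] --> (0 : R) ->
  (forall h : R, 0 < h < h0 ->
    ((c * h `^ eps)%:E <=
     d_infty (distribution_function Q)
             (smoothed_df (distribution_function Q) K h))%E) ->
  (forall n, (0 < n)%N -> 0 < H n) ->
  (\forall n \near \oo, forall t,
    `|empirical_df x n t - distribution_function Q t| <= 3 * n%:R `^ (- delta)) ->
  (\forall n \near \oo, forall t,
    `|empirical_df x n t - kernel_df_estimator K x n (H n) t| <= s n) ->
  (n%:R * H n) @[n --> \oo] --> (0 : R).
Proof.
move=> hK eps0 epsd d1 c0 h00 hso hbias Hpos rate sol.
have d0 : 0 < delta by exact: lt_trans epsd.
pose F := distribution_function Q.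
have iK := kernel_integrable hK.
pose kappa := \int[@lebesgue_measure R]_v `|K v|.
have kappa0 : 0 <= kappa by exact: Rintegral_ge0.
have mF : measurable_fun setT F.
  by apply: nondecreasing_measurable => // u v; exact: distribution_function_le.
have F01 t : `|F t| <= 1.
  by have /andP[? ?] := distribution_function_bounds Q t; rewrite ger0_norm.
have mFn n : measurable_fun setT (empirical_df x n).
  apply: nondecreasing_measurable => // u v uv.
  rewrite /empirical_df ler_wpM2l ?invr_ge0 //; apply: ler_sum => i _.
  by rewrite ler_nat; case: (leP (x i) u) => // xu; rewrite (le_trans xu uv).
have [theta theta0 sep] := estimator_separation hK.
have th4 : 0 < theta / 4 by rewrite divr_gt0.
have [x1 Fx1] := distribution_function_gt0 Q th4.
have [x2 Fx2] := distribution_function_lt1 Q th4.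
(* Each tail beyond [M] has mass below [theta / 4]. Replacing [F] by [F_n] costs at most another
   [theta / 4] per tail, which keeps the proportion of bad observations below [theta]. *)
pose M := Num.max `|x1| `|x2|.
have M0 : 0 <= M by rewrite le_max normr_ge0.
have FM1 : F (- M) < theta / 4.
  apply: le_lt_trans Fx1; apply: distribution_function_le.
  by rewrite lerNl; apply: le_trans (ler_norm _) _; rewrite normrN le_max lexx.
have FM2 : 1 - theta / 4 < F M.
  apply: lt_le_trans Fx2 _; apply: distribution_function_le.
  by apply: le_trans (ler_norm _) _; rewrite le_max lexx orbT.
have [dl dl0 {}sep] := sep h0 M h00 M0.
have ratelim : 3 * n%:R `^ (- delta) @[n --> \oo] --> (0 : R).
  by rewrite -(mulr0 3); apply: cvgM; [exact: cvg_cst|exact: cvg_powRN].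
have small : \forall n \near \oo, H n < h0.
  near=> n.
  have n0 : (0 < n)%N by near: n; exact: nbhs_infty_gt.
  have N1 : 1 <= n%:R :> R by rewrite ler1n.
  rewrite ltNge; apply/negP => h0H.
  have rn : forall t, `|empirical_df x n t - F t| <= 3 * n%:R `^ (- delta).
    by near: n.
  have rth : 3 * n%:R `^ (- delta) <= theta / 4.
    rewrite -[leLHS]ger0_norm ?mulr_ge0 ?powR_ge0 //.
    by near: n; move/cvgr0Pnorm_le : ratelim => /(_ _ th4).
  (* As [n ^ eps >= 1], the assumption on [n ^ eps * s n] controls [s n] once [s n >= 0], which is
     read off the distance bound. *)
  have snd : s n < dl.
    have : n%:R `^ eps * s n < dl.
      apply: le_lt_trans (ler_norm _) _.
      by near: n; move/cvgr0Pnorm_lt : hso => /(_ _ dl0).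
    have sn0 : 0 <= s n.
      have : `|empirical_df x n 0 - kernel_df_estimator K x n (H n) 0| <= s n.
        by near: n; apply: filterS sol => m.
      exact: le_trans.
    apply: le_lt_trans; rewrite ler_peMl //.
    by have := ler_powR N1 (ltW eps0); rewrite powRr0.
  have [|t] := sep n x (H n) n0 h0H.
    apply: (@le_trans _ _ (n%:R * (empirical_df x n (- M) +
        (1 - empirical_df x n M)))).
      rewrite /empirical_df mulrDr mulrBr mulr1 !mulrA divff ?mul1r; last first.
        by rewrite gt_eqF // ltr0n.
      have -> : n%:R = \sum_(i < n) (1 : R) by rewrite sumr_const card_ord.
      rewrite -sumrB -big_split /=; apply: ler_sum => i _.
      have [xM|xM] := leP (x i) (- M).
        have : 0 <= 1 - (x i <= M)%R%:R :> R by rewrite subr_ge0 lern1 leq_b1.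
        move=> h; apply: (@le_trans _ _ 1); first by rewrite lern1 leq_b1.
        by rewrite lerDl.
      have [xM'|xM'] := leP (x i) M; last first.
        by rewrite subr0 add0r lern1 leq_b1.
      by rewrite ltNge ler_norml (ltW xM) xM' subrr addr0.
    rewrite mulrC ler_wpM2r //.
    have := rn (- M); have := rn M.
    rewrite !ler_norml => /andP[h1 _] /andP[_ h2].
    lra.
  rewrite leNgt => /negP; apply; apply: le_lt_trans snd.
  have : forall t, `|empirical_df x n t - kernel_df_estimator K x n (H n) t| <= s n.
    by near: n.
  exact.
(* The bias is at most [(1 + kappa)] times the empirical error plus [s n]; multiplying by [n ^ eps]
   leaves a vanishing right side because [eps < delta]. *)
have key : \forall n \near \oo, c * (n%:R * H n) `^ eps <=
    3 * (1 + kappa) * n%:R `^ (- (delta - eps)) + n%:R `^ eps * s n.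
  near=> n.
  have n0 : (0 < n)%N by near: n; exact: nbhs_infty_gt.
  have N0 : 0 < n%:R :> R by rewrite ltr0n.
  have Hn := Hpos _ n0.
  have Hh0 : H n < h0 by near: n.
  have rn : forall t, `|empirical_df x n t - F t| <= 3 * n%:R `^ (- delta).
    by near: n.
  have sn : forall t, `|empirical_df x n t - kernel_df_estimator K x n (H n) t| <= s n.
    by near: n.
  set r := 3 * n%:R `^ (- delta) in rn.
  have bd : c * H n `^ eps <= r * (1 + kappa) + s n.
    rewrite -lee_fin; apply: (le_trans (hbias (H n) _)); first by rewrite Hn.
    apply: ge_ereal_sup => _ [t _ <-]; rewrite lee_fin -/F.
    have h1 := rn t; have h2 := sn t.
    have h3 := @smoothing_contraction _ K iK F x n (H n) t r Hn mF F01 (mFn n) rn.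
    rewrite -/kappa in h3.
    move: h1 h2 h3; move: (F t) (smoothed_df F K (H n) t) (empirical_df x n t)
      (kernel_df_estimator K x n (H n) t) => p q u v.
    rewrite !ler_norml => /andP[? ?] /andP[? ?] /andP[? ?].
    by apply/andP; split; lra.
  rewrite powRM ?(ltW N0) ?(ltW Hn) // mulrCA.
  apply: le_trans (ler_wpM2l (powR_ge0 _ _) bd) _.
  rewrite mulrDr lerD2r /r.
  have -> : n%:R `^ (- (delta - eps)) = n%:R `^ eps * n%:R `^ (- delta).
    rewrite opprB; apply: powRD; apply/implyP => _; exact: lt0r_neq0.
  suff -> : n%:R `^ eps * (3 * n%:R `^ (- delta) * (1 + kappa)) =
    3 * (1 + kappa) * (n%:R `^ eps * n%:R `^ (- delta)) by [].
  ring.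
have lim0 : 3 * (1 + kappa) * n%:R `^ (- (delta - eps)) + n%:R `^ eps * s n
    @[n --> \oo] --> (0 : R).
  rewrite -(addr0 0); apply: cvgD => //.
  rewrite -(mulr0 (3 * (1 + kappa))); apply: cvgM; first exact: cvg_cst.
  by apply: cvg_powRN; rewrite subr_gt0.
apply/cvgr0Pnorm_lt => e e0.
have ce : 0 < c * e `^ eps by rewrite mulr_gt0 // powR_gt0.
near=> n.
have n0 : (0 < n)%N by near: n; exact: nbhs_infty_gt.
have Hn := Hpos _ n0.
rewrite ger0_norm ?mulr_ge0 ?(ltW Hn) // ltNge; apply/negP => eH.
have : c * e `^ eps <= c * (n%:R * H n) `^ eps.
  rewrite ler_pM2l //; apply: ge0_ler_powR => //; rewrite ?nnegrE ?(ltW e0) ?ltW //.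
  by rewrite mulr_gt0 // ltr0n.
apply/negP; rewrite -ltNge.
apply: (@le_lt_trans _ _ (3 * (1 + kappa) * n%:R `^ (- (delta - eps)) + n%:R `^ eps * s n)).
  by near: n.
apply: le_lt_trans (ler_norm _) _.
by near: n; move/cvgr0Pnorm_lt : lim0 => /(_ _ ce).
Unshelve. all: by end_near. Qed.

(** * The L1 lower bound for compactly supported kernels *)

Section L1LowerBound.
Context (R : realType).
Local Notation mu := (@lebesgue_measure R).

Lemma compactly_supported_radius (K : R -> R) : compactly_supported K ->
  exists2 S : R, 0 < S & forall u, K u != 0 -> `|u| <= S.
Proof.
move=> /compact_bounded /pinfty_ex_gt0 [S S0 HS].
by exists S => // u Ku; apply: HS; exact: subset_closure.
Qed.

Lemma limn_einf_ge (u : (\bar R)^nat) (a : R) :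
  (forall e : R, 0 < e -> \forall n \near \oo, ((a - e)%:E <= u n)%E) ->
  (a%:E <= limn_einf u)%E.
Proof.
move=> H; apply/lee_subgt0Pr => e e0; have [N _ HN] := H e e0.
rewrite limn_einf_lim; apply: (@le_trans _ _ (einfs u N)).
  by apply: le_ereal_inf_tmp => _ [m /= Nm <-]; exact: HN.
rewrite (cvg_lim _ (ereal_nondecreasing_cvgn (@nondecreasing_einfs _ u))) //.
by apply: ereal_sup_ubound; exists N.
Qed.

Lemma density_estimator_L1_lower_bound (K f : R -> R) (S a b : R)
    (x : nat -> R) (n : nat) (h : R) :
  measurable_fun setT K -> measurable_fun setT f ->
  (forall u, K u != 0 -> `|u| <= S) -> 0 < S -> 0 < b -> 0 < h ->
  (a%:E <= mu [set y | (b <= f y)%R])%E ->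
  ((b * (a - 2 * S * (n%:R * h)))%:E <=
   Lnorm mu 1 (fun y => (kernel_density_estimator K x n h y - f y)%:E))%E.
Proof.
move=> mK mf KS S0 b0 h0 aE.
pose E := [set y | b <= f y]; pose B i : set R := `[x i - S * h, x i + S * h]%classic.
pose A : set R := \big[setU/set0]_(i < n) B i.
have mE : measurable E by exact: measurable_superlevel.
have mB i : measurable (B i) by exact: measurable_itv.
have mA : measurable A by exact: bigsetU_measurable.
have mD : measurable (E `\` A) by exact: measurableD.
have muA : (mu A <= (2 * S * (n%:R * h))%:E)%E.
  apply: (le_trans (@Boole_inequality _ _ _ mu B n (fun i _ => mB i))).
  apply: (@le_trans _ _ (\sum_(i < n) (2 * S * h)%:E)%E).
    apply: lee_sum => i _; rewrite [leLHS]lebesgue_measure_itv /= lte_fin.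
    case: ifP => _; last by rewrite lee_fin !mulr_ge0 // ltW.
    by rewrite -EFinB lee_fin (_ : x i + S * h - (x i - S * h) = 2 * S * h) //; ring.
  rewrite sumEFin sumr_const card_ord lee_fin -[_ *+ n]mulr_natl.
  by rewrite (_ : n%:R * (2 * S * h) = 2 * S * (n%:R * h)) //; ring.
(* [E] may have infinite measure, so it is covered by [A] and the difference set instead of
   subtracting measures. *)
have muD : ((a - 2 * S * (n%:R * h))%:E <= mu (E `\` A))%E.
  rewrite EFinB leeBlDl //; apply: (le_trans aE).
  apply: (@le_trans _ _ (mu (A `|` (E `\` A)))).
    apply: le_measure; rewrite ?inE //; first exact: measurableU.
    by move=> y Ey; have [Ay|Ay] := pselect (A y); [left|right].
  apply: (@le_trans _ _ (mu A + mu (E `\` A))%E); first exact: measureU2.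
  exact: leeD.
rewrite Lnorm1.
have mfh : measurable_fun setT (kernel_density_estimator K x n h).
  apply: measurable_funM; first exact: measurable_cst.
  apply: measurable_sum => i; apply: measurableT_comp => //.
  apply: measurable_funM; last exact: measurable_cst.
  by apply: measurable_funB; [exact: measurable_id|exact: measurable_cst].
have mg : measurable_fun setT
    (fun y => `|(kernel_density_estimator K x n h y - f y)%:E|%E).
  apply: measurableT_comp => //; apply/measurable_EFinP.
  exact: measurable_funB.
apply: (@le_trans _ _ (\int[mu]_(y in E `\` A) b%:E)%E).
  by rewrite integral_cst // EFinM lee_pmul2l.
apply: (@le_trans _ _ (\int[mu]_(y in E `\` A)
    `|(kernel_density_estimator K x n h y - f y)%:E|)%E).
  apply: ge0_le_integral => //.
  - by move=> y _; rewrite lee_fin ltW.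
  - exact: measurable_funTS.
  - move=> y [Ey nAy] /=; rewrite lee_fin.
    rewrite /kernel_density_estimator big1 ?mulr0 ?sub0r ?normrN; last first.
      move=> i _; apply/eqP; apply: contrapT => /negP /KS.
      rewrite normrM normfV (gtr0_norm h0) ler_pdivrMr // ler_norml => /andP[h1 h2].
      apply: nAy; rewrite /A -bigcup_mkord; exists (i : nat); first exact: (ltn_ord i).
      rewrite /B /= in_itv /=; apply/andP; split; lra.
    by apply: le_trans (ler_norm _).
by apply: ge0_subset_integral.
Qed.

End L1LowerBound.

Theorem theorem2p3 (R : realType) (disp : measure_display)
    (T : measurableType disp) (P : probability T R)
    (l : nat) (K : R -> R) (hK : is_kernel l K)
    (d : (R -> R) -> (R -> R) -> \bar R)
    (hd : d = @d_infty R \/ exists2 k : nat, (1 <= k)%N & d = @d_kuip R k)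
    (s : nat -> R) (hs : forall n, (1 <= n)%N -> 0 < s n)
    (eps : R) (heps : 0 < eps < 1 / 2)
    (hso : (n%:R `^ eps * s n) @[n --> \oo] --> (0 : R))
    (Q : probability R R) (f : R -> R) (hf : is_lebesgue_density Q f)
    (X : nat -> {RV P >-> R}) (hX : iid_sample Q X)
    (c h0 : R) (hc : 0 < c) (hh0 : 0 < h0)
    (hbias : forall h : R, 0 < h < h0 ->
      ((c * h `^ eps)%:E <=
       d_infty (distribution_function Q)
               (smoothed_df (distribution_function Q) K h))%E)
    (h : nat -> {RV P >-> R})
    (hpos : forall n w, (1 <= n)%N -> 0 < h n w)
    (hsol : \forall w \ae P, \forall n \near \oo,
      d (empirical_df (fun i => X i w) n)
        (kernel_df_estimator K (fun i => X i w) n (h n w)) = (s n)%:E) :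
  (\forall w \ae P, (n%:R * h n w) @[n --> \oo] --> (0 : R)) /\
  (compactly_supported K ->
   forall a b : R, 0 < a -> 0 < b ->
     (a%:E <= lebesgue_measure [set x | (b <= f x)%R])%E ->
     \forall w \ae P,
       (0 < (a * b)%:E <=
        limn_einf (fun n =>
          Lnorm (@lebesgue_measure R) 1 (fun x =>
            (kernel_density_estimator K (fun i => X i w) n (h n w) x
             - f x)%:E)))%E).
Proof.
have [eps0 eps1] := andP heps.
have iK := kernel_integrable hK.
(* The midpoint of [eps] and [1 / 2]: small enough for the almost sure rate, large enough to beat
   [n ^ eps]. *)
pose delta := (eps + 1 / 2) / 2.
have epsd : eps < delta by rewrite /delta; lra.
have d12 : 0 < delta < 1 / 2 by rewrite /delta; lra.
have [d0 d1] := andP d12.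
have collapse : \forall w \ae P, (n%:R * h n w) @[n --> \oo] --> (0 : R).
  have rate := empirical_df_rate hX (distribution_function_continuous hf) d12.
  apply: (filterS2 _ _ rate hsol) => w ratew solw.
  apply: (@bandwidth_collapse R l K Q s eps delta c h0 (fun i => X i w)
    (fun n => h n w)) => //.
  - by lra.
  - by move=> n n0; exact: hpos.
  - near=> n => t.
    have n0 : (0 < n)%N by near: n; exact: nbhs_infty_gt.
    have N1 : 1 <= n%:R :> R by rewrite ler1n.
    have rn : forall t, `|empirical_df (fun i => X i w) n t -
        distribution_function Q t| <= n%:R `^ (- delta) + 2 / n.+1%:R.
      by near: n.
    apply: le_trans (rn t) _.
    (* The grid term [2 / n.+1] is absorbed into the rate, since [delta < 1]. *)
    have -> : 3 * n%:R `^ (- delta) = n%:R `^ (- delta) + 2 * n%:R `^ (- delta) by ring.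
    rewrite lerD2l ler_pM2l //; apply: (@le_trans _ _ n%:R^-1).
      by rewrite lef_pV2 ?posrE ?ltr0n // ler_nat.
    rewrite -powR_inv1 ?ler0n // ler_powR //.
    by rewrite lerN2; lra.
  - near=> n.
    have n0 : (0 < n)%N by near: n; exact: nbhs_infty_gt.
    have : d (empirical_df (fun i => X i w) n)
        (kernel_df_estimator K (fun i => X i w) n (h n w)) = (s n)%:E by near: n.
    case: hd => [->|[k k1 ->]] dn; first by apply: d_infty_uniform; rewrite dn.
    apply: (d_kuip_uniform k1); last by rewrite dn.
    rewrite -(subrr 0); apply: cvgB; first exact: empirical_df_cvg0.
    exact: (kernel_df_estimator_cvg0 iK _ _ (hpos n w n0)).
split=> // /compactly_supported_radius [S S0 KS] a b a0 b0 abf.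
have mK : measurable_fun setT K by apply/measurable_EFinP; exact: measurable_int iK.
have [mf _ _] := hf.
apply: filterS collapse => w nh0; rewrite lte_fin mulr_gt0 //=.
apply: limn_einf_ge => e e0.
have bS : 0 < b * (2 * S) by rewrite !mulr_gt0.
near=> n.
have n0 : (0 < n)%N by near: n; exact: nbhs_infty_gt.
have := density_estimator_L1_lower_bound (fun i => X i w) n mK mf KS S0 b0
  (hpos n w n0) abf.
apply: le_trans; rewrite lee_fin.
(* Makes the loss [b * 2 * S * n * h] in the L1 bound at most [e]. *)
have nhe : n%:R * h n w <= e / (b * (2 * S)).
  apply: le_trans (ler_norm _) _; near: n.
  by move/cvgr0Pnorm_le : nh0; apply; rewrite divr_gt0.
rewrite mulrBr [a * b]mulrC lerD2l lerN2.
rewrite (_ : b * _ = n%:R * h n w * (b * (2 * S))); last by ring.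
by rewrite -ler_pdivlMr.
Unshelve. all: by end_near. Qed.
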